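(* Let $(X_n)_{n\in\mathbb{N}}$ be a Wasserstein contractive Markov chain with transition kernel $P$, unique invariant distribution $\pi$ and initial distribution $\nu$ (so $X_1\sim\nu$), with $\nu\ll\pi$ and $\frac{d\nu}{d\pi}\in L^q(\pi)$ for some $q\in(1,\infty)$ with Hoelder conjugate $s\in(1,\infty)$. Assume that $\varepsilon_r<\infty$ for $r=2s$. Assume further that there is a constant $\widehat{C}>0$ such that for every forcing function $g\in\mathscr{L}_0$, with $R_n^*=R_n^*(g)$ as defined in the context, $$\mathbb{E}_\nu\left[|R_n^*|^2\right]\le\widehat{C}\,n\,\|g\|_d^2\qquad\text{for all } n\in\mathbb{N}.$$ Then for any $n\in\mathbb{N}$ and any $t>0$, $$\sup_{f\in\mathscr{L}_0;\ \|f\|_d\le1}\mathbb{P}_\nu\left[S_n^*f>t\right]\le\frac{4n}{t^2}\left(4\left\|\frac{d\nu}{d\pi}\right\|_{L^q(\pi)}(\Lambda\varepsilon_r)^2+\widehat{C}\right).$$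
   Context: $(\mathcal{X},\rho)$ is a non-trivial (more than one point) Polish space with Borel $\sigma$-algebra $\mathcal{B}(\mathcal{X})$, and $d:\mathcal{X}\times\mathcal{X}\to[0,\infty)$ is a metric that is lower semi-continuous with respect to the product topology induced by $\rho$. For probability measures $\mu_1,\mu_2$ on $\mathcal{X}$, $\mathcal{W}(\mu_1,\mu_2)=\inf_{\eta}\int d(x,y)\,\eta(dx,dy)\in[0,\infty]$, the infimum running over all couplings $\eta$ of $\mu_1,\mu_2$. For a Markov kernel $K$ on $\mathcal{X}$, $\tau(K)=\sup_{x\ne y}\mathcal{W}(K(x,\cdot),K(y,\cdot))/d(x,y)$, and $Kf(x)=\int f(x')K(x,dx')$; $K^n$ is the $n$-th iterate, $K^0$ the identity kernel. A Markov chain with transition kernel $P$ is Wasserstein contractive if $\tau(P)<\infty$ and $\tau(P^m)<1$ for some $m\in\mathbb{N}=\{1,2,\dots\}$; in that case $\Lambda:=\sum_{n=0}^\infty\tau(P^n)<\infty$. $\|f\|_d:=\sup_{x\neq y}|f(x)-f(y)|/d(x,y)$; $\mathscr{L}$ is the space of all measurable $f:\mathcal{X}\to\mathbb{R}$ with $\|f\|_d<\infty$, and $\mathscr{L}_0=\{f\in\mathscr{L}:\int f\,d\pi=0\}$. $E_1(x)=\int_{\mathcal{X}}d(x,y)\,\pi(dy)$ and $\varepsilon_p=\left(\int_{\mathcal{X}}E_1(x)^p\,\pi(dx)\right)^{1/p}\in[0,\infty]$. If $\varepsilon_p<\infty$ for some $p\in(1,\infty)$ then $E_1$ is finite, and for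 each $g\in\mathscr{L}_0$ there is exactly one $u\in\mathscr{L}_0$ with $u-Pu=g$ (the solution of Poisson's equation with forcing function $g$); one sets $R_n^*=R_n^*(g)=\max_{1\le k\le n}|u(X_1)-u(X_{k+1})|$. $\mathbb{P}_\nu,\mathbb{E}_\nu$ refer to the chain started from $X_1\sim\nu$. $S_n^*f=\max_{1\le k\le n}\left|\sum_{j=1}^kf(X_j)\right|$. *)

(* Defs.v *)
(* MathComp-Analysis *)
From HB Require Import structures.
From mathcomp Require Import all_boot all_order all_algebra.
From mathcomp Require Import all_classical all_reals all_analysis.

Set Implicit Arguments.
Unset Strict Implicit.
Unset Printing Implicit Defensive.

Import Order.TTheory GRing.Theory Num.Theory.
Import numFieldNormedType.Exports.

Local Open Scope classical_set_scope.
Local Open Scope ring_scope.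
Local Open Scope ereal_scope.

(* A complete separable metric space (with metric [mdist]) carrying its Borel
   sigma-algebra. *)
HB.mixin Record isBorelSeparable (disp : measure_display) (R : realType) T
    & Metric R T & Measurable disp T := {
  separable : exists2 D : set T, countable D & dense D ;
  measurable_borel : @measurable disp T = <<s @open T >>
}.

#[short(type="polishType")]
HB.structure Definition Polish (disp : measure_display) (R : realType) :=
  {T of Metric R T & Complete T & Measurable disp T & isBorelSeparable disp R T}.

(* [d] is a second metric, not the one generating the topology. *)
Definition is_metric (T : Type) (R : realType) (d : T -> T -> R) : Prop :=
  [/\ forall x y, (0 <= d x y)%R,
      forall x y, d x y = 0%R <-> x = y,
      forall x y, d x y = d y x &
      forall x y z, (d x z <= d x y + d y z)%R].

Definition lsc_metric (disp : measure_display) (R : realType)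
    (T : polishType disp R) (d : T -> T -> R) : Prop :=
  is_metric d /\ lower_semicontinuous (fun z : T * T => (d z.1 z.2)%:E).

Section Wasserstein.
Context {disp : measure_display} {R : realType} {T : measurableType disp}.
Variable d : T -> T -> R.

Definition coupling (mu1 mu2 : {measure set T -> \bar R}) :
    set (probability (T * T)%type R) :=
  [set eta | forall A, measurable A ->
     eta (fst @^-1` A) = mu1 A /\ eta (snd @^-1` A) = mu2 A].

Definition wasserstein (mu1 mu2 : {measure set T -> \bar R}) : \bar R :=
  ereal_inf [set \int[eta]_z (d z.1 z.2)%:E | eta in coupling mu1 mu2].

Definition tau (K : T -> {measure set T -> \bar R}) : \bar R :=
  ereal_sup [set wasserstein (K z.1) (K z.2) / (d z.1 z.2)%:E
            | z in [set z : T * T | z.1 <> z.2]].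

Fixpoint kiter (K : R.-spker T ~> T) (n : nat) : R.-spker T ~> T :=
  if n is m.+1 then mkcomp_noparam (kiter K m) K
  else kdirac (@measurable_id _ T setT).

Definition kapply (K : T -> {measure set T -> \bar R}) (f : T -> R) (x : T) :
    \bar R :=
  \int[K x]_y (f y)%:E.

Definition wasserstein_contractive (P : R.-pker T ~> T) : Prop :=
  tau P < +oo /\ exists2 m, (0 < m)%N & tau (kiter P m) < 1.

Definition Lambda (P : R.-pker T ~> T) : \bar R :=
  \sum_(0 <= n <oo) tau (kiter P n).

Definition invariant (P : R.-pker T ~> T) (pi : probability T R) : Prop :=
  forall A, measurable A -> \int[pi]_x P x A = pi A.

Definition unique_invariant (P : R.-pker T ~> T) (pi : probability T R) :
    Prop :=
  invariant P pi /\
  forall mu : probability T R, invariant P mu ->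
    forall A, measurable A -> mu A = pi A.

Definition dnorm (f : T -> R) : \bar R :=
  ereal_sup [set (`|f z.1 - f z.2| / d z.1 z.2)%:E
            | z in [set z : T * T | z.1 <> z.2]].

Definition Lip : set (T -> R) :=
  [set f | measurable_fun setT f /\ dnorm f < +oo].

Definition Lip0 (pi : probability T R) : set (T -> R) :=
  [set f | [/\ Lip f, pi.-integrable setT (EFin \o f)
             & \int[pi]_x (f x)%:E = 0]].

Definition E1 (pi : probability T R) (x : T) : \bar R :=
  \int[pi]_y (d x y)%:E.

Definition eps (pi : probability T R) (p : R) : \bar R :=
  'N[pi]_p%:E[E1 pi].

Definition poisson_solution (P : R.-pker T ~> T) (pi : probability T R)
    (g : T -> R) : set (T -> R) :=
  [set u | Lip0 pi u /\ forall x, (u x)%:E - kapply P u x = (g x)%:E].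

(* The solution [u]; [get] returns a junk value only when there is none. *)
Definition poisson (P : R.-pker T ~> T) (pi : probability T R) (g : T -> R) :
    T -> R :=
  get (poisson_solution P pi g).

(* Processes are indexed from 1: the value at index 0 plays no role below. *)
Section Process.
Context {disp' : measure_display} {Omega : measurableType disp'}.

Definition history (X : nat -> Omega -> T) (n : nat) : set (set Omega) :=
  <<s \bigcup_(k in [set k | (1 <= k <= n)%N])
        preimage_set_system setT (X k) measurable >>.

(* The second clause says that [P (X n) A] is a version of the conditional
   probability of [X n.+1 \in A] given the sigma-algebra of the past. *)
Definition markov_chain (P : R.-pker T ~> T) (nu : probability T R)
    (Pr : probability Omega R) (X : nat -> {RV Pr >-> T}) : Prop :=
  (forall A, measurable A -> distribution Pr (X 1%N) A = nu A) /\
  (forall n A B, (1 <= n)%N -> measurable A -> history X n B ->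
     Pr (B `&` X n.+1 @^-1` A) = \int[Pr]_(w in B) P (X n w) A).

(* The maxima are of nonnegative numbers over a nonempty range when [0 < n]. *)
Definition Sstar (X : nat -> Omega -> T) (f : T -> R) (n : nat) (w : Omega) :
    R :=
  \big[Num.max/0%R]_(1 <= k < n.+1) `|\sum_(1 <= j < k.+1) f (X j w)|%R.

Definition Rstar (P : R.-pker T ~> T) (pi : probability T R)
    (X : nat -> Omega -> T) (g : T -> R) (n : nat) (w : Omega) : R :=
  let u := poisson P pi g in
  \big[Num.max/0%R]_(1 <= k < n.+1) `|u (X 1%N w) - u (X k.+1 w)|%R.

End Process.

End Wasserstein.

(* Main.v *)
Require Import Defs.
From HB Require Import structures.
From mathcomp Require Import all_boot all_order all_algebra.
From mathcomp Require Import all_classical all_reals all_analysis.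
From mathcomp Require Import measurable_realfun giry.
From mathcomp Require Import ring lra.

Set Implicit Arguments.
Unset Strict Implicit.
Unset Printing Implicit Defensive.

Import Order.TTheory GRing.Theory Num.Theory.
Import numFieldNormedType.Exports.

Local Open Scope classical_set_scope.
Local Open Scope ring_scope.
Local Open Scope charge_scope.
Local Open Scope ereal_scope.

(** The idea is to replace the sum by a martingale through Poisson's equation. If
    [u - P u = f], then summing along the chain and telescoping gives

      sum_(1 <= j <= k) f (X_j) = u (X_1) - u (X_(k+1)) + M_k,
      M_k = sum_(1 <= j <= k) (u (X_(j+1)) - P u (X_j)),

    so that if [S_n^*] exceeds [t] then [R_n^*] or [max_k |M_k|] exceeds [t/2]. The
    first event is handled by Chebyshev's inequality and the assumed bound on the
    second moment of [R_n^*]. For the second one, [M] is a martingale, and Doob's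
    inequality ([doob_kolmogorov]) leaves the second moment of [M_n], which is at
    most the sum of the [n] moments [E u(X_(j+1))^2] ([mart_sqr_le]). Both facts
    rest on conditioning on the past, [markov_tower].

    It remains to bound [E u(X_(j+1))^2]. A kernel multiplies Lipschitz constants by
    at most [tau] ([kapplyR_lipd]: integrate against a nearly optimal coupling), and a
    centred [L]-Lipschitz function is at most [L E_1] pointwise
    ([lipd_centered_bound]). Hence [P^n f] is at most [tau(P^n) E_1], the series
    [sum_n P^n f] converges to a solution of Poisson's equation, and every solution
    is at most [Lambda E_1] ([poisson_solution_series], [poisson_solution_bound]).
    Finally the law of [X_(j+1)] is [nu P^j], and Hoelder's inequality on the measure
    [pi(dx) P^j(x, dy)], both of whose marginals are [pi], yields
    [E E_1(X_(j+1))^2 <= ||dnu/dpi||_q eps_(2s)^2] ([density_moment_le],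
    [e1_sqr_chain]). The argument gives the constant one where the theorem has
    four.

    If [Lambda] is infinite, the right-hand side is infinite too, except when [eps] is
    zero; then [E_1(X_j) = 0] almost surely, and the sums vanish
    ([Sstar_tail_degenerate]). *)

(** * Joint measurability of the metric *)

Section measurable_metric.
Context {disp : measure_display} {R : realType} {T : polishType disp R}.

Lemma open_measurable_polish (U : set T) : open U -> measurable U.
Proof. by move=> oU; rewrite measurable_borel; exact: sub_gen_smallest. Qed.

(** Product measurability only knows rectangles, so an open set has to be a
    countable union of open rectangles. Separability provides them: [V i n] is
    the interior of the ball of radius [1/(n+1)] around the point that the
    enumeration [f] of the dense set numbers [i] (and is empty if there is no
    such point). *)
Lemma open_measurable_prod (O : set (T * T)) : open O -> measurable O.
Proof.
move=> oO; have [D /countable_injP[f finj] dD] := separable (s := T).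
pose V i n : set T :=
  \bigcup_(p in [set p | D p /\ f p = i]) (ball p (n.+1%:R^-1 : R))°.
have mV i n : measurable (V i n).
  by apply: open_measurable_polish; apply: bigcup_open => p _; exact: open_interior.
pose W (k : nat * nat * nat) := V k.1.1 k.2 `*` V k.1.2 k.2.
have -> : O = \bigcup_k (if pselect (W k `<=` O) then W k else set0).
  apply/seteqP; split => [[x y] Oxy|z [k _]]; last first.
    by case: pselect => // WO; exact: WO.
  have : nbhs (x, y) O by apply: open_nbhs_nbhs; split.
  case=> -[A B] [/= xA yB] ABO.
  have /nbhs_ballP[a /= a0 xaA] := xA; have /nbhs_ballP[b /= b0 ybB] := yB.
  pose e := (Num.min a b / 2)%R.
  have e0 : (0 < e)%R by rewrite divr_gt0// lt_min a0.
  have [n _ /(_ n (leqnn n)) ne] := near_infty_natSinv_lt (PosNum e0).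
  have r0 : (0 < n.+1%:R^-1 / 2 :> R)%R by rewrite divr_gt0.
  (* A dense point at distance below half of the radius [1/(n+1)] sees [z] in
     its own ball. *)
  have near_dense z : exists2 p, D p & ball z (n.+1%:R^-1 / 2)%R p.
    have : (ball z (n.+1%:R^-1 / 2 : R))° !=set0.
      by exists z; exact: nbhsx_ballx.
    by move=> /dD[]; [exact: open_interior|move=> p [/interior_subset ? ?]; exists p].
  have inV z p : D p -> ball z (n.+1%:R^-1 / 2)%R p -> V (f p) n z.
    move=> Dp zp; exists p => //; apply/nbhs_ballP; exists (n.+1%:R^-1 / 2)%R => //= w zw.
    by rewrite (splitr n.+1%:R^-1); apply: ball_triangle zw; exact: ball_sym.
  have subV z c p : (2 * e <= c)%R -> D p -> ball z (n.+1%:R^-1 / 2)%R p ->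
      V (f p) n `<=` ball z c.
    move=> ec Dp zp w [p' [Dp' /finj pp']]; rewrite pp' ?inE// => /interior_subset pw.
    have := ball_triangle zp pw; apply: le_ball; apply: le_trans ec.
    move: ne r0; rewrite [X in (_ < X)%R]/=; set r : R := (n.+1%:R^-1)%R; lra.
  have [p Dp xp] := near_dense x; have [p' Dp' yp'] := near_dense y.
  have WO : W (f p, f p', n) `<=` O.
    move=> [u v] [/= /(subV x a) Vu /(subV y b) Vv]; apply: ABO; split=> /=.
      by apply/xaA/Vu => //; rewrite /e mulrC divfK ?ge_min ?lexx.
    by apply/ybB/Vv => //; rewrite /e mulrC divfK ?ge_min ?lexx ?orbT.
  exists (f p, f p', n) => //; case: pselect => // ?.
  by split; exact: inV.
apply: countable_bigcupT_measurable => // k; case: pselect => //= ?.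
by apply: measurableX; exact: mV.
Qed.

(** Lower semicontinuity says that the sets [{a < d}] are open. Without the joint
    measurability of [d] none of the transport costs below could be split or
    compared. *)
Lemma measurable_lsc_metric (d : T -> T -> R) : lsc_metric d ->
  measurable_fun [set: T * T] (fun z => d z.1 z.2).
Proof.
move=> [_ /lower_semicontinuousP od].
apply/measurable_EFinP; apply: (measurability _ (ErealGenOInfty.measurableE R)).
move=> _ [_ [a ->]] <-; rewrite setTI; apply: open_measurable_prod.
by rewrite preimage_itvoy; exact: od.
Qed.

End measurable_metric.

(** * Integrals against mixtures of measures *)

Section spker_giry.
Context {d1 d2 : measure_display} {X : measurableType d1} {Y : measurableType d2}
  {R : realType}.
Variable K : R.-spker X ~> Y.

Section pointwise.
Variable x : X.
Let mu : set Y -> \bar R := K x.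
HB.instance Definition _ := Measure.on mu.
Let mu_le1 : mu setT <= 1. Proof. exact: sprob_kernel_le1. Qed.
HB.instance Definition _ := Measure_isSubProbability.Build _ _ _ mu mu_le1.
Definition giry_of_spker : giry Y R := mu.
End pointwise.

Lemma measurable_giry_of_spker : measurable_fun setT giry_of_spker.
Proof. by apply: measurable_giry_codensity => // B mB; exact: measurable_kernel. Qed.

(** Invariance of a measure, iteration of a kernel, and the laws of the chain
    all say that some [m] is the mixture of the [K x]; this is the form in which
    each of them is integrated. *)
Lemma ge0_integral_mixture (lam : giry X R) (m : {measure set Y -> \bar R})
    (f : Y -> \bar R) :
  (forall A, measurable A -> m A = \int[lam]_x K x A) ->
  measurable_fun [set: Y] f -> (forall y, 0 <= f y) ->
  \int[m]_y f y = \int[lam]_x \int[K x]_y f y.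
Proof.
move=> mE mf f0.
have := giry_int_bind lam measurable_giry_of_spker mf f0.
rewrite /giry_int => <-; apply: eq_measure_integral => A mA _.
rewrite mE//; apply: esym.
have := @giry_int_map _ _ _ _ _ _ measurable_giry_of_spker lam (giry_ev ^~ A).
by apply => //; exact: measurable_giry_ev.
Qed.

End spker_giry.

(** * Kernels acting on Lipschitz functions *)

Section lipschitz.
Context {disp : measure_display} {R : realType} {T : measurableType disp}.
Variable d : T -> T -> R.
Hypothesis dM : is_metric d.
Hypothesis md : measurable_fun [set: T * T] (fun z => d z.1 z.2).

(** Inequality form of [dnorm d f <= L%:E], which stays in [R]. *)
Definition lipd (L : R) (f : T -> R) := forall x y, (`|f x - f y| <= L * d x y)%R.

Lemma is_metric_ge0 x y : (0 <= d x y)%R. Proof. by case: dM. Qed.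
Lemma is_metric_gt0 x y : x <> y -> (0 < d x y)%R.
Proof.
by case: dM => d0 dE _ _ xy; rewrite lt0r d0 andbT; apply/eqP => /dE.
Qed.

Lemma lipdP (L : R) (f : T -> R) : dnorm d f <= L%:E -> lipd L f.
Proof.
move=> fL x y; have [->|/eqP xy] := eqVneq x y.
  have [_ dE _ _] := dM.
  by rewrite subrr normr0 (dE y y).2// mulr0.
rewrite -ler_pdivrMr ?is_metric_gt0// -lee_fin; apply: le_trans fL.
by apply: ereal_sup_ubound; exists (x, y).
Qed.

Lemma dnorm_le (L : R) (f : T -> R) : lipd L f -> dnorm d f <= L%:E.
Proof.
move=> fL; apply: ge_ereal_sup => _ [[x y] /= xy <-].
by rewrite lee_fin ler_pdivrMr ?is_metric_gt0.
Qed.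

Lemma lipd_dnorm_lty (f : T -> R) : dnorm d f < +oo -> exists2 L, (0 <= L)%R & lipd L f.
Proof.
move=> fy; exists (Num.max 0%R (fine (dnorm d f))); first by rewrite le_max lexx.
apply: lipdP; move: fy; case: (dnorm d f) => [r| |]//= _; last by rewrite leNye.
by rewrite lee_fin le_max lexx orbT.
Qed.

Section marginals.
Variables (m1 m2 : {measure set T -> \bar R}) (eta : probability (T * T)%type R).
Hypothesis eta12 : coupling m1 m2 eta.

Let m1E (h : T -> \bar R) : \int[m1]_x h x = \int[pushforward eta fst]_x h x.
Proof. by apply: eq_measure_integral => A mA _; have [<-] := eta12 mA. Qed.

Let m2E (h : T -> \bar R) : \int[m2]_x h x = \int[pushforward eta snd]_x h x.
Proof. by apply: eq_measure_integral => A mA _; have [_ <-] := eta12 mA. Qed.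

Lemma coupling_ge0_integral (h : T -> \bar R) : measurable_fun [set: T] h ->
    (forall x, 0 <= h x) ->
  \int[m1]_x h x = \int[eta]_z h z.1 /\ \int[m2]_x h x = \int[eta]_z h z.2.
Proof.
by move=> mh h0; rewrite m1E m2E !ge0_integral_pushforward.
Qed.

Lemma coupling_integrable (f : T -> R) : measurable_fun [set: T] f ->
  (m1.-integrable setT (EFin \o f) <-> eta.-integrable setT (EFin \o (f \o fst))) /\
  (m2.-integrable setT (EFin \o f) <-> eta.-integrable setT (EFin \o (f \o snd))).
Proof.
move=> mf.
have mabs : measurable_fun [set: T] (fun x => `|(f x)%:E|).
  by apply: measurableT_comp => //; exact/measurable_EFinP.
have [e1 e2] := @coupling_ge0_integral (fun x => `|(f x)%:E|) mabs (fun=> abse_ge0 _).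
split; split => /integrableP[_ fy]; apply/integrableP; split.
all: try by do ?[exact/measurable_EFinP|apply: measurableT_comp => //].
- by rewrite -e1.
- by rewrite e1.
- by rewrite -e2.
- by rewrite e2.
Qed.

Lemma coupling_Rintegral (f : T -> R) : measurable_fun [set: T] f ->
  (m1.-integrable setT (EFin \o f) ->
     \int[m1]_x f x = \int[eta]_z f z.1)%R /\
  (m2.-integrable setT (EFin \o f) ->
     \int[m2]_x f x = \int[eta]_z f z.2)%R.
Proof.
move=> mf; have [[i1 _] [i2 _]] := coupling_integrable mf.
split=> [/i1 i|/i2 i]; rewrite /Rintegral ?m1E ?m2E integral_pushforward//.
- exact/measurable_EFinP.
- exact/measurable_EFinP.
Qed.


Variables (c L : R) (f : T -> R).
Hypothesis costc : \int[eta]_z (d z.1 z.2)%:E <= c%:E.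
Hypothesis L0 : (0 <= L)%R.
Hypothesis fL : lipd L f.
Hypothesis mf : measurable_fun [set: T] f.

Let d_int : eta.-integrable setT (fun z => (d z.1 z.2)%:E).
Proof.
apply/integrableP; split; first exact/measurable_EFinP.
rewrite (eq_integral (fun z => (d z.1 z.2)%:E)); first exact: le_lt_trans (ltry c).
by move=> z _; rewrite gee0_abs// lee_fin is_metric_ge0.
Qed.

(** [|f z.1| <= |f z.2| + L d z]: finite transport cost carries integrability
    from one marginal to the other. *)
Lemma coupling_lipd_integrable :
  m2.-integrable setT (EFin \o f) -> m1.-integrable setT (EFin \o f).
Proof.
have [[_ i1] [i2 _]] := coupling_integrable mf => /i2 fi; apply: i1.
apply: (@le_integrable _ _ _ eta _ measurableT _
    (fun z => `|(f z.2)%:E| + L%:E * (d z.1 z.2)%:E)).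
- by apply/measurable_EFinP; exact: measurableT_comp.
- move=> z _ /=; rewrite lee_fin [leRHS]ger0_norm; last first.
    by rewrite addr_ge0// mulr_ge0// is_metric_ge0.
  rewrite -lerBlDl; apply: le_trans (fL _ _); exact: lerB_dist.
- apply: integrableD => //; first exact: integrable_abse.
  exact: integrableZl.
Qed.

(** The elementary half of Kantorovich duality: the difference of the two
    integrals is the integral of [f z.1 - f z.2] against the coupling. *)
Lemma coupling_lipd_diff :
  m1.-integrable setT (EFin \o f) -> m2.-integrable setT (EFin \o f) ->
  (`|\int[m1]_x f x - \int[m2]_x f x| <= L * c)%R.
Proof.
have [[i1 _] [i2 _]] := coupling_integrable mf.
have [e1 e2] := coupling_Rintegral mf.
move=> f1 f2; rewrite e1// e2//.
have {}f1 := i1 f1; have {}f2 := i2 f2.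
rewrite -RintegralB//.
have f12 : eta.-integrable setT (EFin \o (fun z => f z.1 - f z.2)%R).
  exact: (integrableB _ f1 f2).
apply: (le_trans (le_normr_Rintegral _ _)) => //.
apply: (@le_trans _ _ (\int[eta]_z (L * d z.1 z.2))%R).
  apply: le_Rintegral => //=.
  - exact: integrable_abse f12.
  - exact: (integrableZl measurableT L d_int).
rewrite RintegralZl// ler_wpM2l// -lee_fin fineK//.
exact: (integrable_fin_num measurableT d_int).
Qed.

End marginals.

Section kernel_action.
Variables (K : R.-spker T ~> T) (t : R).
Hypothesis t0 : (0 <= t)%R.
Hypothesis tauK : tau d K <= t%:E.

(** The slack [e] stands in for the existence of an optimal coupling. *)
Lemma tau_coupling x y (e : R) : x <> y -> (0 < e)%R ->
  exists2 eta, coupling (K x) (K y) eta &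
    \int[eta]_z (d z.1 z.2)%:E <= (t * d x y + e)%:E.
Proof.
move=> xy e0; have dxy := is_metric_gt0 xy.
have : wasserstein d (K x) (K y) <= t%:E * (d x y)%:E.
  rewrite -lee_pdivrMr//; apply: le_trans tauK.
  have := inver (d x y); rewrite gt_eqF// => <-.
  by apply: ereal_sup_ubound; exists (x, y).
rewrite -EFinM => W; have : wasserstein d (K x) (K y) < (t * d x y + e)%:E.
  by rewrite (le_lt_trans W)// lte_fin ltrDl.
by move=> /ereal_inf_lt[_ [eta c12 <-] /ltW]; exists eta.
Qed.

(** Real-valued form of [kapply], meaningful where [f] is [K x]-integrable. *)
Definition kapplyR (f : T -> R) (x : T) : R := (\int[K x]_y f y)%R.

Variables (L : R) (f : T -> R).
Hypothesis L0 : (0 <= L)%R.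
Hypothesis fL : lipd L f.
Hypothesis mf : measurable_fun [set: T] f.

(** A Lipschitz function that is integrable for one of the measures [K y] is
    integrable for all of them, since these are at finite distance. *)
Lemma kernel_lipd_integrable x y :
  (K y).-integrable setT (EFin \o f) -> (K x).-integrable setT (EFin \o f).
Proof.
have [->//|/eqP xy] := eqVneq x y.
have [eta c12 etac] := tau_coupling xy ltr01.
exact: (coupling_lipd_integrable c12 etac L0 fL mf).
Qed.

(** [tau] bounds the factor by which a kernel changes Lipschitz constants. *)
Lemma kapplyR_lipd : (forall x, (K x).-integrable setT (EFin \o f)) ->
  lipd (t * L) (kapplyR f).
Proof.
move=> fi x y; have [->|/eqP xy] := eqVneq x y.
  by rewrite subrr normr0 mulr_ge0// ?mulr_ge0// is_metric_ge0.
apply/ler_addgt0Pl => e e0.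
have e'0 : (0 < e / (L + 1))%R by rewrite divr_gt0// ltr_wpDl.
have [eta c12 etac] := tau_coupling xy e'0.
rewrite (le_trans (coupling_lipd_diff c12 etac L0 fL mf (fi x) (fi y)))//.
rewrite mulrDr addrC lerD//; last by rewrite mulrCA mulrA.
by rewrite mulrA ler_pdivrMr ?ltr_wpDl// mulrC ler_wpM2l ?ltW// ltrDl.
Qed.

End kernel_action.

End lipschitz.

(** * Real integrals against mixtures *)

Section mixture_integral.
Context {d1 d2 : measure_display} {X : measurableType d1} {Y : measurableType d2}
  {R : realType}.
Variables (K : R.-spker X ~> Y) (f : Y -> R).
Hypothesis mf : measurable_fun [set: Y] f.
Hypothesis fi : forall x, (K x).-integrable setT (EFin \o f).

Let mEf : measurable_fun [set: Y] (EFin \o f).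
Proof. exact/measurable_EFinP. Qed.

Lemma measurable_ge0_kernel_integral (h : Y -> \bar R) :
  measurable_fun [set: Y] h -> (forall y, 0 <= h y) ->
  measurable_fun [set: X] (fun x => \int[K x]_y h y).
Proof.
by move=> mh h0; apply: measurable_fun_integral_kernel => // U; exact: measurable_kernel.
Qed.

Lemma kapplyR_EFin x : (\int[K x]_y f y)%R%:E =
  \int[K x]_y (EFin \o f)^\+ y - \int[K x]_y (EFin \o f)^\- y.
Proof.
rewrite /Rintegral fineK; first exact: integralE.
exact: (integrable_fin_num measurableT (fi x)).
Qed.

Lemma measurable_kapplyR : measurable_fun [set: X] (fun x => \int[K x]_y f y)%R.
Proof.
apply/measurable_EFinP; under [X in measurable_fun _ X]eq_fun do rewrite /= kapplyR_EFin.
apply: emeasurable_funB; apply: measurable_ge0_kernel_integral => //.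
- exact: measurable_funepos.
- exact: measurable_funeneg.
Qed.

Variables (lam : giry X R) (m : {measure set Y -> \bar R}).
Hypothesis mE : forall A, measurable A -> m A = \int[lam]_x K x A.
Hypothesis mfi : m.-integrable setT (EFin \o f).

(** The nonnegative case applies to the positive and the negative part of [f];
    integrability for [m] makes both of their mixtures finite, so that the
    difference can be taken under the outer integral. *)
Lemma mixture_Rintegral :
  (\int[m]_y f y = \int[lam]_x \int[K x]_y f y)%R.
Proof.
rewrite {1}/Rintegral integralE.
rewrite !(ge0_integral_mixture mE)//; last 2 first.
- exact: measurable_funeneg.
- exact: measurable_funepos.
rewrite /Rintegral; congr fine.
under [RHS]eq_integral do rewrite kapplyR_EFin.
have finite_part (h : Y -> \bar R) : measurable_fun setT h -> (forall y, 0 <= h y) ->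
    (forall y, h y <= `|(EFin \o f) y|) ->
    lam.-integrable setT (fun x => \int[K x]_y h y).
  move=> mh h0 hf; apply/integrableP; split; first exact: measurable_ge0_kernel_integral.
  have [_] := integrableP _ _ _ mfi; apply: le_lt_trans.
  rewrite (ge0_integral_mixture mE)//; last exact: measurableT_comp.
  apply: ge0_le_integral => //.
  - by apply: measurableT_comp => //; exact: measurable_ge0_kernel_integral.
  - by apply: measurable_ge0_kernel_integral => //; exact: measurableT_comp.
  - move=> x _; rewrite gee0_abs ?integral_ge0//.
    by apply: ge0_le_integral => //; exact: measurableT_comp.
apply: esym; apply: integralB => //; apply: finite_part => //.
- exact: measurable_funepos.
- by move=> y; rewrite -/((abse \o (EFin \o f)) y) fune_abse leeDl.
- exact: measurable_funeneg.
- by move=> y; rewrite -/((abse \o (EFin \o f)) y) fune_abse leeDr.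
Qed.

End mixture_integral.

(** * Lipschitz functions under an invariant measure *)

Section invariant_lipschitz.
Context {disp : measure_display} {R : realType} {T : measurableType disp}.
Variable d : T -> T -> R.
Hypothesis dM : is_metric d.
Hypothesis md : measurable_fun [set: T * T] (fun z => d z.1 z.2).
Variable pi : probability T R.

Lemma measurable_E1 : measurable_fun [set: T] (E1 d pi).
Proof.
apply: (measurable_fun_fubini_tonelli_F (m2 := pi) (fun z : T * T => (d z.1 z.2)%:E)).
  exact/measurable_EFinP.
by move=> z; rewrite lee_fin (is_metric_ge0 dM).
Qed.

Lemma E1_ge0 x : 0 <= E1 d pi x.
Proof. by apply: integral_ge0 => y _; rewrite lee_fin (is_metric_ge0 dM). Qed.

Hypothesis E1fin : forall x, E1 d pi x < +oo.

(** [E1] as a real function, which it is under [E1fin]. *)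
Definition e1 (x : T) : R := (\int[pi]_y d x y)%R.

Lemma e1E x : (e1 x)%:E = E1 d pi x.
Proof. by rewrite fineK// ge0_fin_numE ?E1_ge0//; exact: E1fin. Qed.

Lemma e1_ge0 x : (0 <= e1 x)%R.
Proof. by rewrite -lee_fin e1E E1_ge0. Qed.

Lemma measurable_e1 : measurable_fun [set: T] e1.
Proof.
apply/measurable_EFinP; rewrite (_ : EFin \o e1 = E1 d pi); first exact: measurable_E1.
by apply/funext => x /=; rewrite e1E.
Qed.

Lemma metric_integrable x : pi.-integrable setT (EFin \o d x).
Proof.
apply/integrableP; split.
  by apply/measurable_EFinP; exact: measurableT_comp md (measurable_pair1 x).
rewrite (eq_integral (fun y => (d x y)%:E)); first exact: E1fin.
by move=> y _; rewrite gee0_abs// lee_fin (is_metric_ge0 dM).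
Qed.

Lemma cst_integrable d' (Z : measurableType d') (m : giry Z R) (c : R) :
  m.-integrable setT (EFin \o cst c).
Proof. exact: finite_measure_integrable_cst. Qed.

Lemma integral_cst_probability (c : \bar R) : \int[pi]_y cst c y = c.
Proof.
rewrite integral_cst// -[RHS]mule1; congr (c * _).
exact: probability_setT.
Qed.

Lemma Rintegral_cst_probability (c : R) : (\int[pi]_y c)%R = c.
Proof.
rewrite Rintegral_cst// -[RHS]mulr1; congr (c * _)%R.
exact: (congr1 fine (probability_setT pi)).
Qed.

Section lipschitz_function.
Variables (L : R) (f : T -> R).
Hypothesis L0 : (0 <= L)%R.
Hypothesis fL : lipd d L f.
Hypothesis mf : measurable_fun [set: T] f.

(** [|f y| <= |f x| + L d x y] for a fixed [x], and [d x] has integral [E1 x]. *)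
Lemma lipd_integrable : pi.-integrable setT (EFin \o f).
Proof.
have [x _] : exists x : T, True.
  apply: contrapT => /forallNP noT.
  have : pi setT = 0 by rewrite (_ : setT = set0) ?measure0// -subset0 => x /noT.
  by rewrite probability_setT => /eqP; rewrite onee_eq0.
apply: (@le_integrable _ _ _ pi _ measurableT _
    (fun y => `|(f x)%:E| + L%:E * (d x y)%:E)).
- exact/measurable_EFinP.
- move=> y _ /=; rewrite lee_fin [leRHS]ger0_norm; last first.
    by rewrite addr_ge0// mulr_ge0// (is_metric_ge0 dM).
  have [_ _ dC _] := dM.
  by rewrite -lerBlDl dC; apply: le_trans (fL _ _); exact: lerB_dist.
- apply: integrableD => //; first exact: (cst_integrable _ `|f x|%R).
  exact: integrableZl (metric_integrable x).
Qed.

(** A centred [f] is [f x = \int (f x - f y) pi(dy)]. Every pointwise bound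
    below, in particular the one on the solution of Poisson's equation,
    is an instance. *)
Lemma lipd_centered_bound x :
  (\int[pi]_y f y)%R = 0%R -> (`|f x| <= L * e1 x)%R.
Proof.
move=> f0.
have fxy_int : pi.-integrable setT (EFin \o (fun y => f x - f y)%R).
  by apply: (integrableB _ (cst_integrable pi (f x)) lipd_integrable).
have -> : f x = (\int[pi]_y (f x - f y))%R.
  rewrite RintegralB//; [|exact: (cst_integrable _ (f x))|exact: lipd_integrable].
  by rewrite f0 subr0 Rintegral_cst_probability.
apply: (le_trans (le_normr_Rintegral _ _)) => //.
rewrite -RintegralZl//; last exact: metric_integrable.
apply: le_Rintegral => //=.
- exact: integrable_abse fxy_int.
- exact: (integrableZl measurableT L (metric_integrable x)).
Qed.

End lipschitz_function.

Lemma e1_lipd : lipd d 1 e1.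
Proof.
have e1_le x y : (e1 x <= d x y + e1 y)%R.
  rewrite -[d x y]Rintegral_cst_probability -RintegralD//; last 2 first.
  - exact: (cst_integrable _ (d x y)).
  - exact: metric_integrable.
  apply: le_Rintegral => //.
  - exact: metric_integrable.
  - exact: (integrableD _ (cst_integrable pi (d x y)) (metric_integrable y)).
  - by move=> z _; have [_ _ _] := dM; exact.
move=> x y; have [_ _ dC _] := dM.
rewrite mul1r ler_norml lerBlDr e1_le andbT.
by rewrite -opprB lerN2 lerBlDr dC e1_le.
Qed.

Section invariant_kernel.
Variable K : R.-spker T ~> T.
Hypothesis piK : forall A, measurable A -> \int[pi]_x K x A = pi A.

Let piE A : measurable A -> pi A = \int[pi]_x K x A.
Proof. by move=> /piK. Qed.

Lemma invariant_ge0_integral (h : T -> \bar R) :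
  measurable_fun [set: T] h -> (forall y, 0 <= h y) ->
  \int[pi]_x h x = \int[pi]_x \int[K x]_y h y.
Proof. by move=> mh h0; exact: (ge0_integral_mixture piE). Qed.

Variable t : R.
Hypothesis t0 : (0 <= t)%R.
Hypothesis tauK : tau d K <= t%:E.

Variables (L : R) (f : T -> R).
Hypothesis L0 : (0 <= L)%R.
Hypothesis fL : lipd d L f.
Hypothesis mf : measurable_fun [set: T] f.

(** By invariance [|f|] is [K y]-integrable for [pi]-almost every [y], hence for
    some [y]; couplings carry this to every [x]. *)
Lemma invariant_kernel_integrable x : (K x).-integrable setT (EFin \o f).
Proof.
have mabs : measurable_fun [set: T] (fun y => `|(f y)%:E|).
  by apply: measurableT_comp => //; exact/measurable_EFinP.
suff [y Ky] : exists y, (K y).-integrable setT (EFin \o f).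
  exact: (kernel_lipd_integrable dM md tauK L0 fL mf x Ky).
apply: contrapT => /forallNP noint.
have /integrableP[_] := lipd_integrable L0 fL mf.
rewrite (invariant_ge0_integral mabs)//.
rewrite (eq_integral (cst +oo)); last first.
  move=> y _; apply/eqP; rewrite -leye_eq leNgt; apply/negP => Ky; apply: (noint y).
  by apply/integrableP; split => //; exact/measurable_EFinP.
by rewrite integral_cst_probability.
Qed.

Lemma invariant_kapplyR_lipd : lipd d (t * L) (kapplyR K f).
Proof. exact: (kapplyR_lipd dM md t0 tauK L0 fL mf invariant_kernel_integrable). Qed.

Lemma measurable_invariant_kapplyR : measurable_fun [set: T] (kapplyR K f).
Proof. exact: (measurable_kapplyR mf invariant_kernel_integrable). Qed.

Lemma invariant_Rintegral_kapplyR : (\int[pi]_x kapplyR K f x = \int[pi]_x f x)%R.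
Proof.
apply: esym; apply: (mixture_Rintegral mf invariant_kernel_integrable piE).
exact: (lipd_integrable L0 fL mf).
Qed.

End invariant_kernel.

End invariant_lipschitz.

(** * Poisson's equation *)

Section iterates.
Context {disp : measure_display} {R : realType} {T : measurableType disp}.
Variable d : T -> T -> R.
Hypothesis dM : is_metric d.
Hypothesis md : measurable_fun [set: T * T] (fun z => d z.1 z.2).
Variable pi : probability T R.
Hypothesis E1fin : forall x, E1 d pi x < +oo.
Variable P : R.-pker T ~> T.
Hypothesis piP : Defs.invariant P pi.

Lemma kiter_invariant n A : measurable A -> \int[pi]_x kiter P n x A = pi A.
Proof.
elim: n A => [|n IHn] A mA.
  by rewrite -[in RHS](setIT A) -integral_indic.
rewrite -(piP mA); apply: esym.
rewrite (invariant_ge0_integral IHn)//; exact: measurable_kernel.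
Qed.

Variable tP : R.
Hypothesis tP0 : (0 <= tP)%R.
Hypothesis tauP : tau d P <= tP%:E.
Variable tn : nat -> R.
Hypothesis tn0 : forall n, (0 <= tn n)%R.
Hypothesis taun : forall n, tau d (kiter P n) <= (tn n)%:E.

Let Q := @kapplyR disp R T P.

Section lipschitz_function.
Variables (L : R) (f : T -> R).
Hypothesis L0 : (0 <= L)%R.
Hypothesis fL : lipd d L f.
Hypothesis mf : measurable_fun [set: T] f.

(** [kiter P n.+1] moves by [kiter P n] first, so the last step of the chain is
    integrated out first. *)
Lemma kapplyR_kiterS n : kapplyR (kiter P n.+1) f = kapplyR (kiter P n) (Q f).
Proof.
apply/funext => x.
apply: (mixture_Rintegral mf _ (lam := giry_of_spker (kiter P n) x)) => //.
- move=> y; exact: (invariant_kernel_integrable dM md E1fin piP tauP L0 fL mf).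
- exact: (invariant_kernel_integrable dM md E1fin (kiter_invariant n.+1) (taun n.+1) L0 fL mf).
Qed.

Lemma kapplyR_kiter0 : kapplyR (kiter P 0) f = f.
Proof.
apply/funext => x; rewrite /kapplyR /Rintegral /= integral_dirac//; last exact/measurable_EFinP.
by rewrite diracT mul1e.
Qed.

Lemma measurable_Q : measurable_fun [set: T] (Q f).
Proof. exact: (measurable_invariant_kapplyR dM md E1fin piP tauP L0 fL mf). Qed.

Lemma lipd_Q : lipd d (tP * L) (Q f).
Proof. exact: (invariant_kapplyR_lipd dM md E1fin piP tP0 tauP L0 fL mf). Qed.

Lemma kiter_integrable n x : (kiter P n x).-integrable setT (EFin \o f).
Proof.
exact: (invariant_kernel_integrable dM md E1fin (kiter_invariant n) (taun n) L0 fL mf).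
Qed.

Lemma kapplyR_kiter_lipd n : lipd d (tn n * L) (kapplyR (kiter P n) f).
Proof.
exact: (invariant_kapplyR_lipd dM md E1fin (kiter_invariant n) (tn0 n) (taun n) L0 fL mf).
Qed.

Lemma measurable_kapplyR_kiter n : measurable_fun [set: T] (kapplyR (kiter P n) f).
Proof.
exact: (measurable_invariant_kapplyR dM md E1fin (kiter_invariant n) (taun n) L0 fL mf).
Qed.

(** Iterating multiplies the Lipschitz constant by at most [tn n] and keeps the
    function centred. *)
Lemma kapplyR_kiter_bound n x : (\int[pi]_y f y)%R = 0%R ->
  (`|kapplyR (kiter P n) f x| <= tn n * L * e1 d pi x)%R.
Proof.
move=> f0; apply: (lipd_centered_bound dM md E1fin); rewrite ?mulr_ge0//.
- exact: kapplyR_kiter_lipd.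
- exact: measurable_kapplyR_kiter.
- rewrite (invariant_Rintegral_kapplyR dM md E1fin (kiter_invariant n) (taun n) L0 fL mf).
  exact: f0.
Qed.

End lipschitz_function.

Lemma kapplyR_kiter_comm n L (f : T -> R) : (0 <= L)%R -> lipd d L f ->
  measurable_fun [set: T] f -> kapplyR (kiter P n.+1) f = Q (kapplyR (kiter P n) f).
Proof.
elim: n L f => [|n IHn] L f L0 fL mf.
  by rewrite (kapplyR_kiterS L0 fL mf) !kapplyR_kiter0//; exact: (measurable_Q L0 fL mf).
rewrite (kapplyR_kiterS L0 fL mf) (IHn (tP * L)%R).
- by rewrite (kapplyR_kiterS L0 fL mf).
- by rewrite mulr_ge0.
- exact: lipd_Q.
- exact: (measurable_Q L0 fL mf).
Qed.

Variable Lam : R.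
Hypothesis sum_tn : forall n, (\sum_(0 <= k < n) tn k <= Lam)%R.

Let tn_series_cvg : cvgn (series tn).
Proof.
apply: nondecreasing_is_cvgn; last by exists Lam => _ [n _ <-]; exact: sum_tn.
by apply: nondecreasing_series => n _ _; exact: tn0.
Qed.

Let Lam0 : (0 <= Lam)%R.
Proof. by have := sum_tn 0; rewrite big_nil. Qed.

Section poisson_series.
Variable f : T -> R.
Hypothesis fL : lipd d 1 f.
Hypothesis mf : measurable_fun [set: T] f.
Hypothesis f0 : (\int[pi]_y f y)%R = 0%R.

Definition poisson_psum (n : nat) (x : T) : R :=
  (\sum_(0 <= k < n) kapplyR (kiter P k) f x)%R.

Lemma measurable_poisson_psum n : measurable_fun [set: T] (poisson_psum n).
Proof. by apply: measurable_sum => k; exact: (measurable_kapplyR_kiter ler01 fL mf). Qed.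

Lemma poisson_psum_lipd n : lipd d Lam (poisson_psum n).
Proof.
move=> x y; rewrite /poisson_psum -sumrB (le_trans (ler_norm_sum _ _ _))//.
apply: (@le_trans _ _ (\sum_(0 <= k < n) tn k * d x y)%R).
  by apply: ler_sum => k _; have := kapplyR_kiter_lipd ler01 fL mf k x y; rewrite mulr1.
by rewrite -mulr_suml ler_wpM2r ?sum_tn// (is_metric_ge0 dM).
Qed.

Lemma poisson_psum_bound n x : (`|poisson_psum n x| <= Lam * e1 d pi x)%R.
Proof.
rewrite /poisson_psum (le_trans (ler_norm_sum _ _ _))//.
apply: (@le_trans _ _ (\sum_(0 <= k < n) tn k * e1 d pi x)%R).
  apply: ler_sum => k _.
  by have := kapplyR_kiter_bound ler01 fL mf k x f0; rewrite mulr1.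
by rewrite -mulr_suml ler_wpM2r ?sum_tn// (e1_ge0 dM).
Qed.

(** The partial sums solve Poisson's equation up to a shift of the index. *)
Lemma poisson_psumS n x : poisson_psum n.+1 x = (f x + Q (poisson_psum n) x)%R.
Proof.
elim: n => [|n IHn].
  rewrite /poisson_psum big_nat1 kapplyR_kiter0// /Q /kapplyR /Rintegral.
  under eq_integral do rewrite big_nil.
  by rewrite integral0 addr0.
rewrite {1}/poisson_psum big_nat_recr//= -/(poisson_psum _ _) IHn -addrA; congr (_ + _)%R.
have psumi : (P x).-integrable setT (EFin \o poisson_psum n).
  exact: (invariant_kernel_integrable dM md E1fin piP tauP Lam0
    (poisson_psum_lipd n) (measurable_poisson_psum n)).
rewrite -/(kiter P n.+1) (kapplyR_kiter_comm n ler01 fL mf) -RintegralD//.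
  by congr fine; apply: eq_integral => y _; rewrite /poisson_psum big_nat_recr.
by apply: (invariant_kernel_integrable dM md E1fin piP tauP _
  (kapplyR_kiter_lipd ler01 fL mf n) (measurable_kapplyR_kiter ler01 fL mf n)); rewrite mulr1.
Qed.

Definition poisson_series (x : T) : R := limn (poisson_psum ^~ x).

Lemma cvg_poisson_psum x : poisson_psum n x @[n --> \oo] --> poisson_series x.
Proof.
apply: normed_cvg; apply: (@series_le_cvg _ _ (fun k => e1 d pi x * tn k)%R) => [k|k|k|].
- exact: normr_ge0.
- by rewrite mulr_ge0 ?tn0// (e1_ge0 dM).
- by rewrite mulrC; have := kapplyR_kiter_bound ler01 fL mf k x f0; rewrite mulr1.
- exact: is_cvg_seriesZ.
Qed.

Lemma measurable_poisson_series : measurable_fun [set: T] poisson_series.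
Proof.
apply: (measurable_fun_cvg measurable_poisson_psum) => x _; exact: cvg_poisson_psum.
Qed.

Lemma poisson_series_lipd : lipd d Lam poisson_series.
Proof.
move=> x y.
have cxy : `|poisson_psum n x - poisson_psum n y|%R @[n --> \oo] -->
    `|poisson_series x - poisson_series y|%R.
  by apply: cvg_norm; apply: cvgB; exact: cvg_poisson_psum.
apply: (ler_cvg_to cxy (cvg_cst (Lam * d x y)%R)).
by apply: nearW => n; exact: poisson_psum_lipd.
Qed.

(** Dominated convergence with majorant [Lam * e1]; it is used for [m = pi],
    where it centres the series, and for [m = P x], where it passes to the limit
    in [poisson_psumS]. *)
Lemma cvg_Rintegral_poisson_psum (m : giry T R) :
  m.-integrable setT (EFin \o e1 d pi) ->
  (\int[m]_x poisson_psum n x)%R @[n --> \oo] --> (\int[m]_x poisson_series x)%R.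
Proof.
move=> ie1.
have cE x : [set: T] x ->
    (poisson_psum n x)%:E @[n --> \oo] --> (poisson_series x)%:E.
  by move=> _; apply: cvg_EFin; [exact: nearW|exact: cvg_poisson_psum].
have [Ui _ cU] := @dominated_convergence _ _ _ m setT measurableT
  (fun n x => (poisson_psum n x)%:E) (EFin \o poisson_series)
  (fun x => Lam%:E * (e1 d pi x)%:E)
  (fun n => (measurable_EFinP _ _).2 (measurable_poisson_psum n))
  ((measurable_EFinP _ _).2 measurable_poisson_series)
  (aeW _ cE)
  (integrableZl measurableT Lam ie1)
  (aeW _ (fun x n _ => poisson_psum_bound n x)).
apply: fine_cvg; rewrite fineK; last exact: integrable_fin_num Ui.
exact: cU.
Qed.

Lemma Rintegral_centeredP (g : T -> R) : pi.-integrable setT (EFin \o g) ->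
  \int[pi]_x (g x)%:E = 0 <-> (\int[pi]_x g x)%R = 0%R.
Proof.
move=> gi; rewrite /Rintegral; split => [->//|g0].
by rewrite -[LHS]fineK ?g0//; exact: (integrable_fin_num measurableT gi).
Qed.

Lemma kapplyE (g : T -> R) x : (P x).-integrable setT (EFin \o g) ->
  kapply P g x = (Q g x)%:E.
Proof. by move=> gi; rewrite /kapply fineK//; exact: (integrable_fin_num measurableT gi). Qed.

Lemma e1_integrable_pi : pi.-integrable setT (EFin \o e1 d pi).
Proof.
exact: (lipd_integrable dM md E1fin ler01 (e1_lipd dM md E1fin) (measurable_e1 dM md E1fin)).
Qed.

Lemma poisson_solution_series : poisson_solution d P pi f poisson_series.
Proof.
have Ui : pi.-integrable setT (EFin \o poisson_series).
  exact: (lipd_integrable dM md E1fin Lam0 poisson_series_lipd measurable_poisson_series).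
have fi : pi.-integrable setT (EFin \o f).
  exact: (lipd_integrable dM md E1fin ler01 fL mf).
split=> [|x].
  split=> //.
    split; first exact: measurable_poisson_series.
    by rewrite (le_lt_trans (dnorm_le dM poisson_series_lipd))// ltry.
  apply/Rintegral_centeredP => //.
  have psum0 n : (\int[pi]_x poisson_psum n x)%R = 0%R.
    rewrite /poisson_psum; elim: n => [|n IHn].
      by under eq_Rintegral do rewrite big_nil; rewrite Rintegral_cst_probability.
    under eq_Rintegral do rewrite big_nat_recr//=.
    rewrite RintegralD//; last 2 first.
    - exact: (lipd_integrable dM md E1fin Lam0 (poisson_psum_lipd n)
        (measurable_poisson_psum n)).
    - apply: (lipd_integrable dM md E1fin _ (kapplyR_kiter_lipd ler01 fL mf n)
        (measurable_kapplyR_kiter ler01 fL mf n)); by rewrite mulr1.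
    rewrite IHn add0r.
    by rewrite (invariant_Rintegral_kapplyR dM md E1fin (kiter_invariant n) (taun n) ler01 fL mf).
  rewrite -(cvg_lim _ (cvg_Rintegral_poisson_psum (m := pi) e1_integrable_pi))//.
  by under eq_fun do rewrite psum0; exact: lim_cst.
rewrite kapplyE; last first.
  exact: (invariant_kernel_integrable dM md E1fin piP tauP Lam0
    poisson_series_lipd measurable_poisson_series).
rewrite -EFinB; congr EFin; apply/eqP; rewrite subr_eq; apply/eqP.
have e1P : (P x).-integrable setT (EFin \o e1 d pi).
  exact: (invariant_kernel_integrable dM md E1fin piP tauP ler01
    (e1_lipd dM md E1fin) (measurable_e1 dM md E1fin)).
have cQ := cvg_Rintegral_poisson_psum (m := giry_of_spker P x) e1P.
have cU : (f x + Q (poisson_psum n) x)%R @[n --> \oo] --> poisson_series x.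
  under eq_fun do rewrite -poisson_psumS.
  by move: (@cvg_poisson_psum x); rewrite -cvg_shiftS.
apply: (cvg_unique (@Rhausdorff R) cU).
by apply: cvgD; [exact: cvg_cst|exact: cQ].
Qed.

(** Iterating [v = f + P v] gives [v = psum n + P^n v], where the remainder is at
    most [tn n * L * e1] and tends to zero. So the bound holds for any solution,
    whichever of them [poisson] selects. *)
Lemma poisson_solution_bound (v : T -> R) :
  poisson_solution d P pi f v -> forall x, (`|v x| <= Lam * e1 d pi x)%R.
Proof.
move=> [[[mv /(lipd_dnorm_lty dM)[L L0 vL]] vi v0] vP] x.
have {}v0 := (Rintegral_centeredP vi).1 v0.
have vE y : v y = (f y + Q v y)%R.
  have := vP y; rewrite kapplyE; last first.
    exact: (invariant_kernel_integrable dM md E1fin piP tauP L0 vL mv).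
  by rewrite -EFinB => -[<-]; rewrite subrK.
have step n : kapplyR (kiter P n) v x = (kapplyR (kiter P n) f x + kapplyR (kiter P n.+1) v x)%R.
  rewrite (kapplyR_kiterS L0 vL mv) {1}/kapplyR.
  under eq_Rintegral do rewrite vE.
  rewrite RintegralD//.
  - exact: (kiter_integrable ler01 fL mf).
  - exact: (kiter_integrable (mulr_ge0 tP0 L0) (lipd_Q L0 vL mv) (measurable_Q L0 vL mv)).
have expand n : v x = (poisson_psum n x + kapplyR (kiter P n) v x)%R.
  elim: n => [|n IHn]; first by rewrite /poisson_psum big_nil add0r kapplyR_kiter0.
  by rewrite IHn step addrA /poisson_psum big_nat_recr.
have tn_cvg0 : ((Lam + tn n * L) * e1 d pi x)%R @[n --> \oo] --> ((Lam + 0 * L) * e1 d pi x)%R.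
  apply: cvgMl; apply: cvgD; first exact: cvg_cst.
  by apply: cvgMl; exact: cvg_series_cvg_0 tn_series_cvg.
rewrite mul0r addr0 in tn_cvg0.
apply: (ler_cvg_to (cvg_cst `|v x|%R) tn_cvg0); apply: nearW => n.
rewrite (expand n) (le_trans (ler_normD _ _))// mulrDl lerD//.
  exact: poisson_psum_bound.
exact: kapplyR_kiter_bound.
Qed.

End poisson_series.

End iterates.

(** * The martingale of a function of the chain *)

Lemma measurable_tail (disp : measure_display) (R : realType)
    (Omega : measurableType disp) (Y : Omega -> R) (a : R) :
  measurable_fun [set: Omega] Y -> measurable [set w | (a < Y w)%R].
Proof.
move=> mY.
have /(_ measurableT [set true] I) := measurable_fun_ltr (measurable_cst a) mY.
by rewrite setTI.
Qed.

Section conditional_square.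
Context {disp : measure_display} {R : realType} {T : measurableType disp}.
Variables (mu : giry T R) (u : T -> R).
Hypothesis mu1 : mu setT = 1.
Hypothesis mesu : measurable_fun [set: T] u.
Hypothesis ui : mu.-integrable setT (EFin \o u).
Local Notation m := (\int[mu]_y u y)%R.

Let Rcst (c : R) : (\int[mu]_y c)%R = c.
Proof.
rewrite Rintegral_cst// -[RHS]mulr1; congr (c * _)%R; exact: (congr1 fine mu1).
Qed.

Let icst (c : R) : mu.-integrable setT (EFin \o cst c).
Proof. exact: finite_measure_integrable_cst. Qed.

Let iaff (a b : R) : mu.-integrable setT (EFin \o (fun y => a + b * u y)%R).
Proof. exact: (integrableD _ (icst a) (integrableZl measurableT b ui)). Qed.

Let Raff (a b : R) : (\int[mu]_y (a + b * u y) = a + b * m)%R.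
Proof.
rewrite RintegralD//; [|exact: icst|exact: (integrableZl measurableT b ui)].
by rewrite Rcst RintegralZl.
Qed.

(** Integrate [c^2 + 2 c (u - m) <= (c + (u - m))^2]: the cross term vanishes, and
    [u] may fail to be square integrable. *)
Lemma integral_sqr_shift_ge (c : R) :
  (c ^+ 2)%:E <= \int[mu]_y ((c + (u y - m)) ^+ 2)%:E.
Proof.
set I := \int[mu]_y _; have [/eqP -> |Iy] := boolP (I == +oo); first by rewrite leey.
have I0 : 0 <= I by apply: integral_ge0 => y _; rewrite lee_fin sqr_ge0.
have mI : measurable_fun [set: T] (fun y => (c + (u y - m)) ^+ 2)%R.
  apply: measurable_funX; apply: measurable_funD => //.
  exact: measurable_funB.
have sqi : mu.-integrable setT (EFin \o (fun y => (c + (u y - m)) ^+ 2)%R).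
  apply/integrableP; split; first exact/measurable_EFinP.
  rewrite (eq_integral (fun y => ((c + (u y - m)) ^+ 2)%:E)) ?ltey// => y _.
  by rewrite gee0_abs// lee_fin sqr_ge0.
rewrite -[I]fineK ?ge0_fin_numE ?ltey// lee_fin.
have -> : (c ^+ 2 = \int[mu]_y ((c ^+ 2 - 2 * c * m) + 2 * c * u y))%R.
  by rewrite Raff; ring.
apply: le_Rintegral => // y _.
rewrite -subr_ge0 (_ : (_ - _)%R = (u y - m) ^+ 2)%R ?sqr_ge0//.
ring.
Qed.

(** The left side is [c^2] plus the variance of [u], when [u] is square
    integrable. *)
Lemma integral_sqr_shift_le (c : R) :
  \int[mu]_y ((c + (u y - m)) ^+ 2)%:E <= (c ^+ 2)%:E + \int[mu]_y (u y ^+ 2)%:E.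
Proof.
set I := \int[mu]_y (u y ^+ 2)%:E.
have [/eqP -> |Iy] := boolP (I == +oo); first by rewrite addey// leey.
have I0 : 0 <= I by apply: integral_ge0 => y _; rewrite lee_fin sqr_ge0.
have sqi : mu.-integrable setT (EFin \o (fun y => u y ^+ 2)%R).
  apply/integrableP; split; first exact/measurable_EFinP/measurable_funX.
  rewrite (eq_integral (fun y => (u y ^+ 2)%:E)) ?ltey// => y _.
  by rewrite gee0_abs// lee_fin sqr_ge0.
have iexp : mu.-integrable setT
    (EFin \o (fun y => u y ^+ 2 + ((c - m) ^+ 2 + 2 * (c - m) * u y))%R).
  exact: (integrableD _ sqi (iaff _ _)).
have -> : \int[mu]_y ((c + (u y - m)) ^+ 2)%:E =
    (\int[mu]_y (u y ^+ 2 + ((c - m) ^+ 2 + 2 * (c - m) * u y)))%R%:E.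
  rewrite fineK; last exact: (integrable_fin_num measurableT iexp).
  by apply: eq_integral => y _; congr EFin; ring.
rewrite -[I]fineK ?ge0_fin_numE ?ltey// -EFinD lee_fin RintegralD//.
rewrite Raff addrC lerD// -subr_ge0.
rewrite (_ : (_ - _)%R = m ^+ 2)%R ?sqr_ge0//.
ring.
Qed.

End conditional_square.

Section markov_chain.
Context {disp : measure_display} {R : realType} {T : measurableType disp}.
Variable P : R.-pker T ~> T.
Variable nu : probability T R.
Context {disp' : measure_display} {Omega : measurableType disp'}.
Variables (Pr : probability Omega R) (X : nat -> {RV Pr >-> T}).
Hypothesis XM : markov_chain P nu X.

(** Generators of [history X n], named so that the past can be the measurable
    space [H n]. *)
Definition past (n : nat) : set (set Omega) :=
  \bigcup_(k in [set k | (1 <= k <= n)%N]) preimage_set_system setT (X k) measurable.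

Local Notation H n := (g_sigma_algebraType (past n)).

Lemma measurable_past n k : (1 <= k <= n)%N -> measurable_fun [set: H n] (X k).
Proof.
move=> kn _ A mA; rewrite setTI; apply: sub_gen_smallest.
by exists k => //; exists A => //; rewrite setTI.
Qed.

Lemma past_le m n : (m <= n)%N -> <<s past m >> `<=` <<s past n >>.
Proof.
move=> mn; apply: smallest_sub; first exact: smallest_sigma_algebra.
move=> _ [k /= /andP[k1 km] [A mA <-]].
apply: sub_gen_smallest; exists k => /=; first by rewrite k1 (leq_trans km).
by exists A.
Qed.

Lemma past_measurable n A : <<s past n >> A -> measurable A.
Proof.
apply: smallest_sub; first exact: sigma_algebra_measurable.
by move=> _ [k _ [B mB <-]]; rewrite setTI -[X in measurable X]setTI; exact: measurable_funP.
Qed.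

Lemma measurable_id_past n : measurable_fun [set: Omega] (id : Omega -> H n).
Proof. by move=> _ A mA; rewrite setTI preimage_id; exact: past_measurable mA. Qed.

Lemma measurable_fun_past_le m n d' (Y : measurableType d') (f : Omega -> Y) :
  (m <= n)%N -> measurable_fun [set: H m] f -> measurable_fun [set: H n] f.
Proof. by move=> mn mf _ A mA; apply: past_le mn _ _; exact: mf. Qed.

Lemma measurable_fun_past n d' (Y : measurableType d') (f : Omega -> Y) :
  measurable_fun [set: H n] f -> measurable_fun [set: Omega] f.
Proof. by move=> mf _ A mA; apply: past_measurable; exact: (mf measurableT). Qed.

(** Conditioning on the past, as an identity between two measures on
    [H n * T]: the law of [(w, X n.+1 w)] and the mixture of the products of
    [dirac w] with [P (X n w)]. The Markov property is their equality on
    rectangles. *)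
Section tower.
Variable n : nat.
Hypothesis n0 : (0 < n)%N.

Let next (w : Omega) : H n * T := (w : H n, X n.+1 w).

Let mnext : measurable_fun [set: Omega] next.
Proof. by apply/measurable_fun_pairP; split; [exact: measurable_id_past|exact: measurable_funP]. Qed.

Let step (w : Omega) : giry (H n * T)%type R :=
  giry_prod (giry_ret (w : H n), giry_of_spker P (X n w)).

Let mstep : measurable_fun [set: Omega] step.
Proof.
apply: measurableT_comp; first exact: measurable_giry_prod.
apply/measurable_fun_pairP; split.
- exact: measurableT_comp (@measurable_giry_ret _ (H n) R) (@measurable_id_past n).
- exact: measurableT_comp (measurable_giry_of_spker P) (measurable_funP (X n)).
Qed.

Let next_step A : measurable A -> giry_map mnext Pr A = giry_bind Pr mstep A.
Proof.
pose G := [set B `*` C | B in @measurable _ (H n) & C in @measurable _ T].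
apply: (measure_unique G (fun=> setT)).
- by rewrite measurable_prod_measurableType.
- move=> _ _ [B1 mB1 [C1 mC1 <-]] [B2 mB2 [C2 mC2 <-]].
  exists (B1 `&` B2); first exact: measurableI.
  by exists (C1 `&` C2); [exact: measurableI|rewrite setXI].
- by move=> _; exists setT => //; exists setT => //; rewrite setXTT.
- by rewrite bigcup_const//; exists 0%N.
- move=> _ [B mB [C mC <-]].
  transitivity (\int[Pr]_(w in B) P (X n w) C).
    by have [_ /(_ n C B n0 mC mB) <-] := XM.
  rewrite integral_mkcond.
  transitivity (\int[Pr]_w step w (B `*` C)); last first.
    apply: esym.
    have := @giry_int_map _ _ _ _ _ _ mstep Pr (giry_ev ^~ (B `*` C)).
    apply; last by move=> m; exact: measure_ge0.
    by apply: measurable_giry_ev; exact: measurableX.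
  apply: eq_integral => w _.
  rewrite /step [RHS]product_measure1E// /= diracE patchE.
  by case: ifPn => _; rewrite ?mul1e ?mul0e.
- by move=> _; rewrite ltey_eq fin_num_measure.
Qed.

Let int_step (w : Omega) (F : H n * T -> \bar R) :
  measurable_fun [set: H n * T] F -> (forall z, 0 <= F z) ->
  giry_int (step w) F = \int[P (X n w)]_y F (w, y).
Proof.
move=> mF F0; rewrite giry_int_prod1// giry_int_ret//.
exact: (measurable_fun_fubini_tonelli_F (m2 := giry_of_spker P (X n w)) F).
Qed.

Lemma markov_tower (F : H n * T -> \bar R) :
  measurable_fun [set: H n * T] F -> (forall z, 0 <= F z) ->
  \int[Pr]_w F (w, X n.+1 w) = \int[Pr]_w \int[P (X n w)]_y F (w, y).
Proof.
move=> mF F0.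
transitivity (\int[giry_map mnext Pr]_z F z); first by rewrite [RHS]giry_int_map.
rewrite (eq_measure_integral (giry_bind Pr mstep)); last by move=> A mA _; exact: next_step.
by rewrite [LHS]giry_int_bind//; apply: eq_integral => w _; exact: int_step.
Qed.

Lemma measurable_markov_tower (F : H n * T -> \bar R) :
  measurable_fun [set: H n * T] F -> (forall z, 0 <= F z) ->
  measurable_fun [set: Omega] (fun w => \int[P (X n w)]_y F (w, y)).
Proof.
move=> mF F0; under eq_fun do rewrite -(int_step _ mF F0).
by apply: (@measurableT_comp _ _ _ _ _ _ (giry_int ^~ F)) => //; exact: measurable_giry_int.
Qed.

End tower.

(** The Markov property for the trivial event. *)
Lemma markov_marginal n A : measurable A ->
  Pr (X n.+1 @^-1` A) = \int[nu]_x kiter P n x A.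
Proof.
elim: n A => [|n IHn] A mA.
  transitivity (nu A); first by have [+ _] := XM; exact.
  by rewrite -[in LHS](setIT A) -integral_indic.
have [_ /(_ n.+1 A setT isT mA)] := XM.
rewrite setTI => ->; last exact: (@measurableT _ (H n.+1)).
transitivity (\int[giry_map (measurable_funP (X n.+1)) Pr]_y P y A).
  by apply: esym; apply: giry_int_map => //; exact: measurable_kernel.
apply: (ge0_integral_mixture (K := kiter P n) (lam := nu)) => //.
exact: measurable_kernel.
Qed.

Lemma markov_marginal_integral n (h : T -> \bar R) :
  measurable_fun [set: T] h -> (forall x, 0 <= h x) ->
  \int[Pr]_w h (X n.+1 w) = \int[nu]_x \int[kiter P n x]_y h y.
Proof.
move=> mh h0.
transitivity (\int[giry_map (measurable_funP (X n.+1)) Pr]_y h y).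
  by apply: esym; exact: giry_int_map.
by apply: (ge0_integral_mixture (lam := nu)) => // A; exact: markov_marginal.
Qed.

Section martingale.
Variable u : T -> R.
Hypothesis mesu : measurable_fun [set: T] u.
Hypothesis ui : forall x, (P x).-integrable setT (EFin \o u).

Definition mart (k : nat) (w : Omega) : R :=
  (\sum_(1 <= j < k.+1) (u (X j.+1 w) - kapplyR P u (X j w)))%R.

Lemma mart0 w : mart 0 w = 0%R.
Proof. by rewrite /mart big_geq. Qed.

Lemma martS k w :
  mart k.+1 w = (mart k w + (u (X k.+2 w) - kapplyR P u (X k.+1 w)))%R.
Proof. by rewrite /mart big_nat_recr. Qed.

Let mkapplyR : measurable_fun [set: T] (kapplyR P u).
Proof. exact: (measurable_kapplyR mesu ui). Qed.

Lemma measurable_mart k : measurable_fun [set: H k.+1] (mart k).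
Proof.
elim: k => [|k IHk].
  by rewrite (_ : mart 0 = cst 0%R)//; apply/funext => w; rewrite mart0.
rewrite (_ : mart k.+1 = (fun w =>
    mart k w + (u (X k.+2 w) - kapplyR P u (X k.+1 w)))%R); last first.
  by apply/funext => w; exact: martS.
apply: measurable_funD; first exact: measurable_fun_past_le IHk.
apply: measurable_funB.
- by apply: (measurableT_comp mesu); apply: measurable_past; rewrite leqnn.
- by apply: (measurableT_comp mkapplyR); apply: measurable_past; rewrite leqnSn.
Qed.

Let measurable_mart_sqr k A : measurable A ->
  measurable_fun A (fun w => (mart k w ^+ 2)%:E).
Proof.
move=> mA; apply/measurable_EFinP/measurable_funX/measurable_funTS.
exact: measurable_fun_past (@measurable_mart k).
Qed.

Let G k (z : H k.+1 * T) : R :=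
  ((mart k z.1 + (u z.2 - kapplyR P u (X k.+1 z.1))) ^+ 2)%R.

Let mG k : measurable_fun [set: H k.+1 * T] (@G k).
Proof.
apply: measurable_funX; apply: measurable_funD.
  apply: (@measurableT_comp _ _ _ _ _ _ (mart k : H k.+1 -> R)) => //.
  exact: measurable_mart.
apply: measurable_funB; first exact: measurableT_comp.
apply: (measurableT_comp mkapplyR).
by apply: (@measurableT_comp _ _ _ _ _ _ (X k.+1 : H k.+1 -> T)) => //;
  apply: measurable_past; rewrite leqnn.
Qed.

(* Conditional second moment of [mart k.+1] given the past. *)
Let inner k w := \int[P (X k.+1 w)]_y (@G k (w, y))%:E.

Let inner_ge0 k w : 0 <= inner k w.
Proof. by apply: integral_ge0 => y _; rewrite lee_fin sqr_ge0. Qed.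

Let measurable_inner k A : measurable A -> measurable_fun A (inner k).
Proof.
move=> mA; apply: measurable_funTS.
apply: (measurable_markov_tower _ (n := k.+1) (F := fun z => (@G k z)%:E)) => //.
- exact/measurable_EFinP.
- by move=> z; rewrite lee_fin sqr_ge0.
Qed.

Let mart_tower k A : <<s past k.+1 >> A ->
  \int[Pr]_(w in A) (mart k.+1 w ^+ 2)%:E = \int[Pr]_(w in A) inner k w.
Proof.
move=> pA.
pose F (z : H k.+1 * T) : \bar R := (\1_A z.1 * @G k z)%:E.
have mF : measurable_fun [set: H k.+1 * T] F.
  apply/measurable_EFinP; apply: measurable_funM => //.
  have mA : measurable_fun [set: H k.+1] (\1_A : H k.+1 -> R).
    exact: (@measurable_indic _ (H k.+1) R setT A pA).
  exact: (measurableT_comp mA (@measurable_fst _ _ (H k.+1) T)).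
have F0 z : 0 <= F z by rewrite lee_fin mulr_ge0// sqr_ge0.
rewrite integral_mkcond [RHS]integral_mkcond.
transitivity (\int[Pr]_w F (w, X k.+2 w)).
  apply: eq_integral => w _; rewrite /F patchE /= indicE martS.
  by case: ifPn; rewrite ?mul1r ?mul0r.
rewrite markov_tower//; apply: eq_integral => w _; rewrite patchE /F /= indicE.
case: ifPn => _; first by under eq_integral do rewrite mul1r.
by under eq_integral do rewrite mul0r; rewrite integral0.
Qed.

(** The increment is centred given the past, so that it can only increase the
    second moment, on any event of the past. *)
Lemma mart_submartingale k A : <<s past k.+1 >> A ->
  \int[Pr]_(w in A) (mart k w ^+ 2)%:E <= \int[Pr]_(w in A) (mart k.+1 w ^+ 2)%:E.
Proof.
move=> pA; have mA := past_measurable pA.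
rewrite mart_tower//; apply: ge0_le_integral => //.
- by move=> w _; rewrite lee_fin sqr_ge0.
- exact: measurable_mart_sqr.
- exact: measurable_inner.
- move=> w _.
  exact: (@integral_sqr_shift_ge _ _ _ (giry_of_spker P (X k.+1 w)) u
    (prob_kernel _) mesu (ui _) (mart k w)).
Qed.

Lemma mart_sqr_increment k :
  \int[Pr]_w (mart k.+1 w ^+ 2)%:E <=
  \int[Pr]_w (mart k w ^+ 2)%:E + \int[Pr]_w (u (X k.+2 w) ^+ 2)%:E.
Proof.
have mu2 : measurable_fun [set: T] (fun y => (u y ^+ 2)%:E).
  exact/measurable_EFinP/measurable_funX.
have u2_ge0 y : 0 <= (u y ^+ 2)%:E by rewrite lee_fin sqr_ge0.
have mT := @measurableT _ (H k.+1).
have -> : \int[Pr]_w (u (X k.+2 w) ^+ 2)%:E = \int[Pr]_w \int[P (X k.+1 w)]_y (u y ^+ 2)%:E.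
  apply: (markov_tower _ (n := k.+1) (F := fun z => (u z.2 ^+ 2)%:E)) => //.
  exact: (measurableT_comp mu2).
have mPu2 : measurable_fun [set: Omega] (fun w => \int[P (X k.+1 w)]_y (u y ^+ 2)%:E).
  apply: (measurable_markov_tower _ (n := k.+1) (F := fun z => (u z.2 ^+ 2)%:E)) => //.
  exact: (measurableT_comp mu2).
rewrite mart_tower// -ge0_integralD//; last 3 first.
- by move=> w _; rewrite lee_fin sqr_ge0.
- exact: measurable_mart_sqr.
- by move=> w _; exact: integral_ge0.
apply: ge0_le_integral => //.
- exact: measurable_inner.
- by apply: emeasurable_funD => //; exact: measurable_mart_sqr.
- move=> w _.
  exact: (@integral_sqr_shift_le _ _ _ (giry_of_spker P (X k.+1 w)) u
    (prob_kernel _) mesu (ui _) (mart k w)).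
Qed.

Lemma mart_sqr_le (V : \bar R) n :
  (forall k, \int[Pr]_w (u (X k.+2 w) ^+ 2)%:E <= V) ->
  \int[Pr]_w (mart n w ^+ 2)%:E <= n%:R%:E * V.
Proof.
move=> uV; elim: n => [|n IHn].
  rewrite mul0e; under eq_integral do rewrite mart0 expr0n/=.
  by rewrite integral0.
rewrite (le_trans (mart_sqr_increment n))// -natr1 EFinD ge0_muleDl// mul1e.
exact: leeD.
Qed.

Section doob.
Variable a : R.

(** The event that [|mart j|] exceeds [a] for some [1 <= j <= k], built one time
    step at a time to match the induction in [doob_kolmogorov]. *)
Fixpoint mart_hit (k : nat) : set Omega :=
  if k is k'.+1 then mart_hit k' `|` [set w | (a < `|mart k'.+1 w|)%R] else set0.

Let exceed k : <<s past k.+1 >> [set w | (a < `|mart k w|)%R].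
Proof.
apply: (@measurable_tail _ _ (H k.+1) (fun w => `|mart k w|)%R).
by apply: measurableT_comp => //; exact: measurable_mart.
Qed.

Lemma mart_hit_past k : <<s past k.+1 >> (mart_hit k).
Proof.
elim: k => [|k IHk] /=; first exact: (@measurable0 _ (H 1)).
apply: (@measurableU _ (H k.+2)); last exact: exceed.
exact: past_le IHk.
Qed.

Lemma mart_hitP n w k : (0 < k <= n)%N -> (a < `|mart k w|)%R -> mart_hit n w.
Proof.
elim: n => [|n IHn] /andP[k0]; first by case: k k0.
rewrite leq_eqVlt => /predU1P[kn|]; last first.
  by rewrite ltnS => kn akw; left; apply: IHn => //; rewrite k0.
by subst k => akw; right.
Qed.

Hypothesis a0 : (0 <= a)%R.

(** At step [n.+1] split the event into the part already hit, which belongs to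
    the past so that [mart_submartingale] applies, and the part first hit now,
    where [a^2 <= mart n.+1 ^ 2]. *)
Lemma doob_kolmogorov n :
  (a ^+ 2)%:E * Pr (mart_hit n) <= \int[Pr]_(w in mart_hit n) (mart n w ^+ 2)%:E.
Proof.
elim: n => [|n IHn] /=; first by rewrite measure0 mule0 integral_set0.
set B := [set w | _]; 
have mB : measurable B := past_measurable (@exceed n.+1).
have mhn : measurable (mart_hit n) := past_measurable (@mart_hit_past n).
have mBh : measurable (B `\` mart_hit n) by exact: (measurableD mB mhn).
have -> : mart_hit n `|` B = mart_hit n `|` (B `\` mart_hit n).
  apply/seteqP; split=> w []; [by left| |by left|by case; right].
  by have [hw|nhw] := pselect (mart_hit n w); [left|right].
have disj : mart_hit n `&` (B `\` mart_hit n) = set0.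
  by rewrite setDE setICA setICr setI0.
rewrite measureU// ge0_muleDr// ge0_integral_setU//; last 3 first.
- exact: measurable_mart_sqr (measurableU _ _ mhn mBh).
- by move=> w _; rewrite lee_fin sqr_ge0.
- exact/disj_set2P.
apply: leeD; first exact: le_trans (mart_submartingale (@mart_hit_past n)).
rewrite -integral_cst//; apply: ge0_le_integral => //.
- by move=> w _; rewrite lee_fin sqr_ge0.
- exact: measurable_mart_sqr.
- move=> w [aw _]; rewrite lee_fin -[leRHS]real_normK ?num_real//.
  by rewrite ler_sqr ?nnegrE ?normr_ge0// ltW.
Qed.

End doob.

End martingale.

End markov_chain.

(** * Second moments from the density of the initial law *)

Section density_moment.
Context {disp : measure_display} {R : realType} {T : measurableType disp}.
Variables (pi nu : probability T R) (q s : R).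
Hypothesis nupi : nu `<< pi.
Hypotheses (q1 : (1 < q)%R) (s1 : (1 < s)%R) (qs : (q^-1 + s^-1 = 1)%R).
Local Notation g := ('d (charge_of_finite_measure nu) '/d pi).
Local Notation N := ('N[pi]_q%:E[g]).
Hypothesis Ny : N < +oo.

Let q0 : (0 < q)%R := lt_trans ltr01 q1.
Let s0 : (0 < s)%R := lt_trans ltr01 s1.
(* The version of the density that is nonnegative and finite everywhere. *)
Let gamma x := fine (Radon_Nikodym_SigmaFinite.f nu pi x).

Let gammaE x : (gamma x)%:E = Radon_Nikodym_SigmaFinite.f nu pi x.
Proof. by rewrite fineK//; exact: Radon_Nikodym_SigmaFinite.f_fin_num. Qed.

Let gamma_ge0 x : (0 <= gamma x)%R.
Proof. by rewrite fine_ge0//; exact: Radon_Nikodym_SigmaFinite.f_ge0. Qed.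

Let mgamma : measurable_fun [set: T] gamma.
Proof.
apply/measurable_EFinP.
rewrite (_ : EFin \o gamma = Radon_Nikodym_SigmaFinite.f nu pi).
  by have /integrableP[] := Radon_Nikodym_SigmaFinite.f_integrable nupi.
by apply/funext => x /=; exact: gammaE.
Qed.

Lemma density_Lnorm_gt0 : 0 < N.
Proof.
rewrite lt0e Lnorm_ge0 andbT; apply/eqP => N0.
have g0 := Lnorm_eq0_eq0 (measurable_int _ (Radon_Nikodym_integrable (nu := charge_of_finite_measure nu) nupi)) _ N0.
have : nu setT = \int[pi]_x g x.
  exact: (Radon_Nikodym_integral (nu := charge_of_finite_measure nu) nupi measurableT).
rewrite probability_setT (ae_eq_integral (cst 0))//; last exact: g0.
by rewrite integral0 => /eqP; rewrite onee_eq0.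
Qed.

Let n := fine N.
Let nE : n%:E = N.
Proof. by rewrite fineK// ge0_fin_numE ?Lnorm_ge0//; exact: Ny. Qed.
Let n0 : (0 < n)%R.
Proof. by rewrite -lte_fin nE; exact: density_Lnorm_gt0. Qed.

Let measurable_powR_comp (p : R) (f : T -> R) : measurable_fun [set: T] f ->
  measurable_fun [set: T] (fun x => (f x `^ p)%:E).
Proof.
move=> mf; apply/measurable_EFinP.
exact: measurableT_comp (measurable_powR p) mf.
Qed.

Let gamma_moment : \int[pi]_x ((gamma x / n) `^ q)%:E = 1.
Proof.
have mgq := measurable_powR_comp q mgamma.
have gq : \int[pi]_x (gamma x `^ q)%:E = (n `^ q)%:E.
  rewrite -poweR_EFin nE poweR_Lnorm ?gt_eqF//; apply: ae_eq_integral => //.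
    apply: (@measurableT_comp _ _ _ _ _ _ (fun x : \bar R => x `^ q)) => //.
      exact: measurable_poweR.
    exact: measurableT_comp.
  apply: filterS (ae_eq_Radon_Nikodym_SigmaFinite nupi measurableT) => x /(_ I) <-.
  by move=> _; rewrite -gammaE /= ger0_norm.
under eq_integral => x _ do rewrite powRM ?invr_ge0 ?(ltW n0)// mulrC EFinM.
rewrite ge0_integralZl ?lee_fin ?powR_ge0//; last first.
  by move=> x _; rewrite lee_fin powR_ge0.
rewrite gq -EFinM -powRM ?invr_ge0 ?(ltW n0)// mulVf ?gt_eqF// powR1//.
Qed.

Variable K : R.-spker T ~> T.
Hypothesis piK : forall A, measurable A -> \int[pi]_x K x A = pi A.
Variables (e : T -> R) (delta : R).
Hypothesis me : measurable_fun [set: T] e.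
Hypothesis e0 : forall x, (0 <= e x)%R.
Hypothesis delta0 : (0 < delta)%R.
Hypothesis e_moment : \int[pi]_x ((e x / delta) `^ s)%:E <= 1.

Let b y := ((e y / delta) `^ s)%:E.

Let mb : measurable_fun [set: T] b.
Proof. by apply: measurable_powR_comp; exact: measurable_funM. Qed.

Let b0 y : 0 <= b y. Proof. by rewrite lee_fin powR_ge0. Qed.

Let mE : measurable_fun [set: T] (EFin \o e). Proof. exact/measurable_EFinP. Qed.

(* Young's inequality for [(gamma x / n) * (e y / delta)], multiplied by
   [n * delta]; the two denominators make both moments at most one. *)
Let young x : (\int[K x]_y (e y)%:E) * (gamma x)%:E <=
  (n * delta / q)%:E * ((gamma x / n) `^ q)%:E +
  (n * delta / s)%:E * \int[K x]_y b y.
Proof.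
have -> : (\int[K x]_y (e y)%:E) * (gamma x)%:E =
    \int[K x]_y ((gamma x)%:E * (e y)%:E).
  by rewrite ge0_integralZl ?lee_fin ?gamma_ge0// 1?muleC// => y _; rewrite lee_fin.
have cq0 : (0 <= n * delta / q)%R by rewrite divr_ge0 ?mulr_ge0 ?ltW.
have cs0 : (0 <= n * delta / s)%R by rewrite divr_ge0 ?mulr_ge0 ?ltW.
have c0 : 0 <= (n * delta / q)%:E * ((gamma x / n) `^ q)%:E.
  by rewrite mule_ge0// lee_fin ?powR_ge0.
rewrite -ge0_integralZl ?lee_fin//.
apply: (@le_trans _ _ (\int[K x]_y ((n * delta / q)%:E * ((gamma x / n) `^ q)%:E +
    (n * delta / s)%:E * b y))).
  apply: ge0_le_integral => //.
  - by move=> y _; rewrite -EFinM lee_fin mulr_ge0.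
  - exact: measurable_funeM.
  - by apply: emeasurable_funD => //; exact: measurable_funeM.
  move=> y _; rewrite /b -!EFinM -EFinD lee_fin.
  have -> : (gamma x * e y = n * delta * (gamma x / n * (e y / delta)))%R.
    by field; rewrite !gt_eqF.
  have := conjugate_powR (divr_ge0 (gamma_ge0 x) (ltW n0))
    (divr_ge0 (e0 y) (ltW delta0)) q0 s0 qs.
  move=> /(ler_wpM2l (ltW (mulr_gt0 n0 delta0))) /le_trans; apply.
  by rewrite le_eqVlt; apply/orP; left; apply/eqP; ring.
rewrite ge0_integralD//; last 2 first.
- by move=> y _; rewrite mule_ge0// lee_fin.
- exact: measurable_funeM.
rewrite leeD2r// integral_cst//.
by rewrite -[leRHS]mule1 lee_wpmul2l// sprob_kernel_le1.
Qed.

(** Hoelder's inequality on the measure [pi(dx) K x (dy)]: its first marginal is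
    [pi], its second one is [pi] by invariance, and [nu] has density [gamma] with
    respect to the first. *)
Lemma density_moment_le : \int[nu]_x \int[K x]_y (e y)%:E <= (n * delta)%:E.
Proof.
have mKb := measurable_ge0_kernel_integral K mb b0.
have E0 y : 0 <= (EFin \o e) y by rewrite lee_fin.
have mKe := measurable_ge0_kernel_integral K mE E0.
have n_ge0 := ltW n0; have d_ge0 := ltW delta0; have q_ge0 := ltW q0; have s_ge0 := ltW s0.
rewrite -(Radon_Nikodym_SigmaFinite.change_of_variables nupi _ measurableT mKe); last first.
  by move=> x; exact: integral_ge0.
under eq_integral do rewrite -gammaE.
have mgn : measurable_fun [set: T] (fun x => ((gamma x / n) `^ q)%:E).
  by apply: measurable_powR_comp; exact: measurable_funM.
apply: (@le_trans _ _ (\int[pi]_x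
    ((n * delta / q)%:E * ((gamma x / n) `^ q)%:E +
     (n * delta / s)%:E * \int[K x]_y b y))).
  apply: ge0_le_integral => //.
  - by move=> x _; rewrite mule_ge0 ?lee_fin// integral_ge0.
  - by apply: emeasurable_funM => //; exact/measurable_EFinP.
  - by apply: emeasurable_funD; apply: measurable_funeM.
rewrite ge0_integralD//; last 4 first.
- by move=> x _; rewrite mule_ge0 ?lee_fin ?divr_ge0 ?mulr_ge0 ?powR_ge0.
- exact: measurable_funeM.
- by move=> x _; rewrite mule_ge0 ?lee_fin ?divr_ge0 ?mulr_ge0 ?integral_ge0.
- exact: measurable_funeM.
rewrite !ge0_integralZl ?lee_fin ?divr_ge0 ?mulr_ge0//; last 2 first.
- by move=> x _; exact: integral_ge0.
- by move=> x _; rewrite lee_fin powR_ge0.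
rewrite gamma_moment mule1 -(invariant_ge0_integral piK mb b0).
apply: (@le_trans _ _ ((n * delta / q)%:E + (n * delta / s)%:E * 1)).
  by rewrite leeD2l// lee_wpmul2l// lee_fin ?divr_ge0 ?mulr_ge0.
by rewrite mule1 -EFinD -mulrDr qs mulr1.
Qed.

End density_moment.

(** * Tails of maxima, nonnegative constants and the eccentricity *)

Section bigmax_process.
Context {disp : measure_display} {R : realType} {Omega : measurableType disp}.
Implicit Types F : nat -> Omega -> R.

Lemma measurable_bigmaxr_nat F n :
  (forall k, measurable_fun [set: Omega] (F k)) ->
  measurable_fun [set: Omega] (fun w => \big[Num.max/0%R]_(1 <= k < n.+1) F k w).
Proof.
move=> mF; elim: (index_iota 1 n.+1) => [|k l IHl].
  rewrite [X in measurable_fun _ X](_ : _ = cst 0%R)//.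
  by apply/funext => w; rewrite big_nil.
rewrite [X in measurable_fun _ X](_ : _ = F k \max (fun w =>
    \big[Num.max/0%R]_(j <- l) F j w)).
  exact: measurable_maxr.
by apply/funext => w; rewrite big_cons.
Qed.

Lemma le_bigmaxr_nat F n k w : (0 < k <= n)%N ->
  (F k w <= \big[Num.max/0%R]_(1 <= k < n.+1) F k w)%R.
Proof.
by move=> kn; apply: (le_bigmax_seq 0%R k xpredT (fun k => F k w)); rewrite // mem_index_iota ltnS.
Qed.

Lemma bigmaxr_nat_le F n w (c : R) : (0 <= c)%R ->
  (forall k, (0 < k <= n)%N -> (F k w <= c)%R) ->
  (\big[Num.max/0%R]_(1 <= k < n.+1) F k w <= c)%R.
Proof. by move=> c0 Fc; rewrite big_nat; apply: bigmax_le => // k; rewrite ltnS; exact: Fc. Qed.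

Lemma chebyshev_tail (Pr : probability Omega R) (Y : Omega -> R) (a : R) :
  (0 <= a)%R -> measurable_fun [set: Omega] Y ->
  (a ^+ 2)%:E * Pr [set w | (a < Y w)%R] <= \int[Pr]_w (Y w ^+ 2)%:E.
Proof.
move=> a0 mY; set A := [set w | _].
have mA : measurable A := measurable_tail a mY.
have mY2 : measurable_fun [set: Omega] (fun w => (Y w ^+ 2)%:E).
  exact/measurable_EFinP/measurable_funX.
apply: (@le_trans _ _ (\int[Pr]_(w in A) (Y w ^+ 2)%:E)); last first.
  by apply: ge0_subset_integral => // w _; rewrite lee_fin sqr_ge0.
rewrite -integral_cst//; apply: ge0_le_integral => //.
- by move=> w _; rewrite lee_fin sqr_ge0.
- exact: measurable_funTS.
- by move=> w aw; rewrite lee_fin ler_sqr ?nnegrE// ?ltW// (le_lt_trans a0 aw).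
Qed.

End bigmax_process.

Section wasserstein_nonneg.
Context {disp : measure_display} {R : realType} {T : measurableType disp}.
Variable d : T -> T -> R.
Hypothesis dM : is_metric d.
Hypothesis Tnontrivial : exists x y : T, x <> y.

Lemma wasserstein_ge0 (m1 m2 : {measure set T -> \bar R}) : 0 <= wasserstein d m1 m2.
Proof.
apply: le_ereal_inf_tmp => _ [eta _ <-]; apply: integral_ge0 => z _.
by rewrite lee_fin (is_metric_ge0 dM).
Qed.

Lemma tau_ge0 (K : T -> {measure set T -> \bar R}) : 0 <= tau d K.
Proof.
have [x [y xy]] := Tnontrivial.
apply: (@le_trans _ _ (wasserstein d (K x) (K y) / (d x y)%:E)).
  by rewrite mule_ge0 ?wasserstein_ge0// inve_ge0 lee_fin (is_metric_ge0 dM).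
by apply: ereal_sup_ubound; exists (x, y).
Qed.

Lemma Lambda_ge0 (P : R.-pker T ~> T) : 0 <= Lambda d P.
Proof. by apply: nneseries_ge0 => n _ _; exact: tau_ge0. Qed.

Lemma Lambda_partial_sum (P : R.-pker T ~> T) : Lambda d P < +oo ->
  (forall n, tau d (kiter P n) <= (fine (tau d (kiter P n)))%:E) /\
  (forall n, \sum_(0 <= k < n) fine (tau d (kiter P k)) <= fine (Lambda d P))%R.
Proof.
move=> Lamy.
have part n : \sum_(0 <= k < n) tau d (kiter P k) <= Lambda d P.
  by apply: nneseries_lim_ge => k _ _; exact: tau_ge0.
have tauy n : tau d (kiter P n) < +oo.
  apply: le_lt_trans Lamy; apply: le_trans (part n.+1).
  by rewrite big_nat_recr//= leeDr// sume_ge0// => k _; exact: tau_ge0.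
have tauE n : (fine (tau d (kiter P n)))%:E = tau d (kiter P n).
  by rewrite fineK// ge0_fin_numE// tau_ge0.
split=> n; first by rewrite tauE.
rewrite -lee_fin fineK ?ge0_fin_numE ?Lambda_ge0// -sumEFin.
by under eq_bigr do rewrite tauE; exact: part.
Qed.

End wasserstein_nonneg.

Section eccentricity_moment.
Context {disp : measure_display} {R : realType} {T : measurableType disp}.
Variable d : T -> T -> R.
Hypothesis dM : is_metric d.
Hypothesis md : measurable_fun [set: T * T] (fun z => d z.1 z.2).
Variables (pi : probability T R) (r : R).
Hypothesis r0 : (0 < r)%R.
Hypothesis epsr : eps d pi r < +oo.

Lemma eps_moment : \int[pi]_x E1 d pi x `^ r = eps d pi r `^ r.
Proof.
rewrite poweR_Lnorm ?gt_eqF//; apply: eq_integral => x _.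
by rewrite gee0_abs// (E1_ge0 dM).
Qed.

(** If [E1] were infinite everywhere then [eps] would be; and [E1] is finite
    everywhere once it is at one point, by the triangle inequality. *)
Lemma eps_E1_lty x : E1 d pi x < +oo.
Proof.
have [y E1y] : exists y, E1 d pi y < +oo.
  apply: contrapT => /forallNP E1y.
  have := poweR_lty r epsr; rewrite -eps_moment (eq_integral (cst +oo)).
    by rewrite integral_cst_probability ltxx.
  move=> y _; rewrite (_ : E1 d pi y = +oo) ?poweRyr ?gt_eqF//.
  by apply/eqP; rewrite -leye_eq leNgt; apply/negP; exact: E1y.
have mdx z : measurable_fun [set: T] (fun y => (d z y)%:E).
  by apply/measurable_EFinP; exact: measurableT_comp md (measurable_pair1 z).
apply: (@le_lt_trans _ _ (\int[pi]_z ((d x y)%:E + (d y z)%:E))).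
  apply: ge0_le_integral => //.
  - by move=> z _; rewrite lee_fin (is_metric_ge0 dM).
  - exact: emeasurable_funD.
  - by move=> z _; rewrite -EFinD lee_fin; have [_ _ _] := dM; exact.
rewrite ge0_integralD//; last 2 first.
- by move=> z _; rewrite lee_fin (is_metric_ge0 dM).
- by move=> z _; rewrite lee_fin (is_metric_ge0 dM).
by rewrite (integral_cst_probability pi (d x y)%:E) lte_add_pinfty// ltry.
Qed.

End eccentricity_moment.

Section maximal_sum.
Context {disp disp' : measure_display} {R : realType} {T : measurableType disp}.
Context {Omega : measurableType disp'}.
Variables (Pr : probability Omega R) (X : nat -> {RV Pr >-> T}).

Lemma measurable_Sstar (f : T -> R) n : measurable_fun [set: T] f ->
  measurable_fun [set: Omega] (Sstar X f n).
Proof.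
move=> mf; apply: (measurable_bigmaxr_nat (F := fun k w =>
  `|\sum_(1 <= j < k.+1) f (X j w)|%R)) => k.
apply: measurableT_comp => //; apply: measurable_sum => j.
exact: (measurableT_comp mf).
Qed.

End maximal_sum.

Section eccentricity_along_chain.
Context {disp : measure_display} {R : realType} {T : measurableType disp}.
Variable d : T -> T -> R.
Hypothesis dM : is_metric d.
Hypothesis md : measurable_fun [set: T * T] (fun z => d z.1 z.2).
Variables (pi nu : probability T R) (q s r : R).
Hypothesis nupi : nu `<< pi.
Hypotheses (q1 : (1 < q)%R) (s1 : (1 < s)%R) (qs : (q^-1 + s^-1 = 1)%R).
Local Notation N := ('N[pi]_q%:E['d (charge_of_finite_measure nu) '/d pi]).
Hypothesis Ny : N < +oo.
Hypothesis rE : (r = 2 * s)%R.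
Hypothesis epsr : eps d pi r < +oo.

Let s0 : (0 < s)%R := lt_trans ltr01 s1.
Let r0 : (0 < r)%R. Proof. by rewrite rE mulr_gt0. Qed.
Let E1fin := eps_E1_lty dM md r0 epsr.
Let e := fine (eps d pi r).
Let e_ge0 : (0 <= e)%R. Proof. by rewrite fine_ge0// Lnorm_ge0. Qed.
Let eE : e%:E = eps d pi r. Proof. by rewrite fineK// ge0_fin_numE ?Lnorm_ge0. Qed.

(** [r = 2 s] makes the [s]-th moment of [e1^2] equal to [e^r]. Taking [c] strictly
    above [e^2] includes the case [e = 0]. *)
Lemma e1_sqr_moment (c : R) : (e ^+ 2 < c)%R ->
  \int[pi]_x ((e1 d pi x ^+ 2 / c) `^ s)%:E <= 1.
Proof.
move=> ec; have c0 : (0 < c)%R by rewrite (le_lt_trans _ ec)// sqr_ge0.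
have me := measurable_e1 dM md E1fin; have e1_0 := e1_ge0 dM E1fin.
have sqrE (a : R) : (0 <= a -> (a ^+ 2) `^ s = a `^ r)%R.
  by move=> a0; rewrite -powR_mulrn// -powRrM rE.
have powE x : ((e1 d pi x ^+ 2 / c) `^ s = c^-1 `^ s * e1 d pi x `^ r)%R.
  by rewrite powRM ?sqr_ge0 ?invr_ge0 ?(ltW c0)// sqrE// mulrC.
under eq_integral do rewrite powE EFinM.
rewrite ge0_integralZl ?lee_fin ?powR_ge0//; last 2 first.
- by apply/measurable_EFinP; exact: measurableT_comp (measurable_powR r) me.
- by move=> x _; rewrite lee_fin powR_ge0.
have -> : \int[pi]_x (e1 d pi x `^ r)%:E = (e `^ r)%:E.
  rewrite -poweR_EFin eE -(eps_moment dM pi r0); apply: eq_integral => x _.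
  by rewrite -(e1E dM E1fin) poweR_EFin.
rewrite -EFinM lee_fin -(sqrE e)// -powRM ?sqr_ge0 ?invr_ge0 ?(ltW c0)//.
have -> : 1%R = (1 `^ s)%R :> R by rewrite powR1.
rewrite ge0_ler_powR ?nnegrE ?(ltW s0)// ?mulr_ge0 ?invr_ge0 ?sqr_ge0 ?(ltW c0)//.
by rewrite mulrC ler_pdivrMr// mul1r ltW.
Qed.

Let n := fine N.
Let nE : n%:E = N. Proof. by rewrite fineK// ge0_fin_numE ?Lnorm_ge0//; exact: Ny. Qed.
Let n0 : (0 < n)%R. Proof. by rewrite -lte_fin nE; exact: density_Lnorm_gt0. Qed.

Lemma e1_sqr_mixture (K : R.-spker T ~> T) :
  (forall A, measurable A -> \int[pi]_x K x A = pi A) ->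
  \int[nu]_x \int[K x]_y (e1 d pi y ^+ 2)%:E <= (n * e ^+ 2)%:E.
Proof.
move=> piK; apply/lee_addgt0Pr => a a0; rewrite -EFinD.
have c_gt : (e ^+ 2 < e ^+ 2 + a / n)%R by rewrite ltrDl divr_gt0.
have c0 : (0 < e ^+ 2 + a / n)%R by rewrite (le_lt_trans _ c_gt)// sqr_ge0.
have -> : (n * e ^+ 2 + a = n * (e ^+ 2 + a / n))%R by field; rewrite gt_eqF.
apply: (density_moment_le nupi q1 s1 qs Ny piK _ _ c0 (e1_sqr_moment c_gt)).
- exact: (measurable_funX _ (measurable_e1 dM md E1fin)).
- by move=> x; exact: sqr_ge0.
Qed.

Variable P : R.-pker T ~> T.
Hypothesis piP : Defs.invariant P pi.
Context {disp' : measure_display} {Omega : measurableType disp'}.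
Variables (Pr : probability Omega R) (X : nat -> {RV Pr >-> T}).
Hypothesis XM : markov_chain P nu X.

Lemma e1_sqr_chain k :
  \int[Pr]_w (e1 d pi (X k.+1 w) ^+ 2)%:E <= (n * e ^+ 2)%:E.
Proof.
rewrite (markov_marginal_integral XM k (h := fun x => (e1 d pi x ^+ 2)%:E)).
- exact: e1_sqr_mixture (kiter_invariant piP k).
- exact/measurable_EFinP/(measurable_funX _ (measurable_e1 dM md E1fin)).
- by move=> x; rewrite lee_fin sqr_ge0.
Qed.

(** If [eps] vanishes then [E1], and with it any centred Lipschitz function,
    vanishes along the chain. This is where [Lambda * eps] is zero even for
    infinite [Lambda]. *)
Section degenerate.
Hypothesis e0 : e = 0%R.

Lemma e1_chain_ae0 : {ae Pr, forall w, forall k, e1 d pi (X k.+1 w) = 0%R}.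
Proof.
apply: ae_foralln => k.
have me2 : measurable_fun [set: Omega] (fun w => (e1 d pi (X k.+1 w) ^+ 2)%:E).
  apply/measurable_EFinP/measurable_funX.
  exact: (measurableT_comp (measurable_e1 dM md E1fin)).
have int0 : \int[Pr]_w `|(e1 d pi (X k.+1 w) ^+ 2)%:E| = 0.
  apply/eqP; rewrite eq_le integral_ge0// andbT.
  under eq_integral do rewrite gee0_abs ?lee_fin ?sqr_ge0//.
  by rewrite (le_trans (e1_sqr_chain k))// e0 expr0n mulr0.
have [+ _] := ae_eq_integral_abs Pr measurableT me2.
move=> /(_ int0); apply: filterS => w /(_ I) [] /eqP.
by rewrite sqrf_eq0 => /eqP.
Qed.

Lemma Sstar_tail_degenerate f m (t : R) : (0 < t)%R ->
  Lip0 d pi f -> dnorm d f <= 1 ->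
  Pr [set w | (t < Sstar X f m w)%R] = 0.
Proof.
move=> t0 [[mf _] fi f0] f1.
have {}f0 : (\int[pi]_x f x = 0)%R by rewrite /Rintegral f0.
have fL := lipdP dM f1.
have [A [mA A0 sA]] := e1_chain_ae0.
apply: (subset_measure0 _ mA _ A0).
  exact: measurable_tail (measurable_Sstar X m mf).
move=> w /= tS; apply: sA => /= e1X; move: tS; rewrite ltNge => /negP; apply.
apply: (bigmaxr_nat_le (F := fun k w => `|\sum_(1 <= j < k.+1) f (X j w)|%R)).
  exact: ltW.
move=> k _; rewrite (le_trans _ (ltW t0))// big_nat big1 ?normr0// => j /andP[j0 _].
apply/eqP; rewrite -normr_le0 -(prednK j0) -(e1X j.-1) -[leRHS]mul1r.
exact: (lipd_centered_bound dM md E1fin ler01 fL mf).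
Qed.

End degenerate.

End eccentricity_along_chain.

(** * The maximal inequality *)

Section maximal_inequality.
Context {disp : measure_display} {R : realType} {T : measurableType disp}.
Hypothesis Tnontrivial : exists x y : T, x <> y.
Variable d : T -> T -> R.
Hypothesis dM : is_metric d.
Hypothesis md : measurable_fun [set: T * T] (fun z => d z.1 z.2).
Variables (pi nu : probability T R) (q s r : R).
Hypothesis nupi : nu `<< pi.
Hypotheses (q1 : (1 < q)%R) (s1 : (1 < s)%R) (qs : (q^-1 + s^-1 = 1)%R).
Local Notation N := ('N[pi]_q%:E['d (charge_of_finite_measure nu) '/d pi]).
Hypothesis Ny : N < +oo.
Hypothesis rE : (r = 2 * s)%R.
Hypothesis epsr : eps d pi r < +oo.
Variable P : R.-pker T ~> T.
Hypothesis piP : Defs.invariant P pi.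
Hypothesis tauPy : tau d P < +oo.
Hypothesis Lamy : Lambda d P < +oo.
Context {disp' : measure_display} {Omega : measurableType disp'}.
Variables (Pr : probability Omega R) (X : nat -> {RV Pr >-> T}).
Hypothesis XM : markov_chain P nu X.
Variable f : T -> R.
Hypotheses (f_Lip0 : Lip0 d pi f) (f_dnorm : dnorm d f <= 1).

Let r0 : (0 < r)%R. Proof. by rewrite rE mulr_gt0// (lt_trans ltr01). Qed.
Let E1fin := eps_E1_lty dM md r0 epsr.
Local Notation e := (fine (eps d pi r)).
Local Notation Lam := (fine (Lambda d P)).
Local Notation u := (poisson d P pi f).
Let tP := fine (tau d P).
Let tP0 : (0 <= tP)%R. Proof. by rewrite fine_ge0// tau_ge0. Qed.
Let tauP : tau d P <= tP%:E. Proof. by rewrite fineK// ge0_fin_numE// tau_ge0. Qed.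
Let tn k := fine (tau d (kiter P k)).
Let tn0 k : (0 <= tn k)%R. Proof. by rewrite fine_ge0// tau_ge0. Qed.
Let taun : forall k, tau d (kiter P k) <= (tn k)%:E.
Proof. by have [] := Lambda_partial_sum dM Tnontrivial Lamy. Qed.
Let sum_tn : forall k, (\sum_(0 <= j < k) tn j <= Lam)%R.
Proof. by have [] := Lambda_partial_sum dM Tnontrivial Lamy. Qed.
Let mf : measurable_fun [set: T] f. Proof. by case: f_Lip0 => -[]. Qed.
Let fL : lipd d 1 f. Proof. exact: lipdP. Qed.
Let f0 : (\int[pi]_x f x = 0)%R.
Proof. by case: f_Lip0 => _ _; rewrite /Rintegral => ->. Qed.

Lemma poissonP : poisson_solution d P pi f u.
Proof.
apply: getPex; eexists.
exact: (poisson_solution_series dM md E1fin piP tP0 tauP tn0 taun sum_tn fL mf f0).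
Qed.

Lemma poisson_bound x : (`|u x| <= Lam * e1 d pi x)%R.
Proof.
exact: (poisson_solution_bound dM md E1fin piP tP0 tauP tn0 taun sum_tn fL mf f0 poissonP).
Qed.

Let mu : measurable_fun [set: T] u.
Proof. by case: poissonP => -[[]]. Qed.

Let ui x : (P x).-integrable setT (EFin \o u).
Proof.
have [[[_ /(lipd_dnorm_lty dM)[L L0 uL]] _ _] _] := poissonP.
exact: (invariant_kernel_integrable dM md E1fin piP tauP L0 uL mu).
Qed.

Let uE x : f x = (u x - kapplyR P u x)%R.
Proof.
have [_ /(_ x)] := poissonP; rewrite (kapplyE (ui x)) -EFinB.
by move=> [].
Qed.

(** [f (X j) = u (X j) - P u (X j)], and shifting the first term by one step
    telescopes. *)
Lemma sum_poisson_mart k w : (\sum_(1 <= j < k.+1) f (X j w) =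
  u (X 1%N w) - u (X k.+1 w) + mart P X u k w)%R.
Proof.
elim: k => [|k IHk]; first by rewrite big_geq// mart0 subrr addr0.
rewrite big_nat_recr//= IHk martS uE; ring.
Qed.

(** [|u| <= Lam * e1] along the chain. *)
Lemma poisson_sqr_chain k :
  \int[Pr]_w (u (X k.+2 w) ^+ 2)%:E <= (Lam ^+ 2 * (fine N * e ^+ 2))%:E.
Proof.
have me1 := measurableT_comp (measurable_e1 dM md E1fin) (measurable_funP (X k.+2)).
have me2 : measurable_fun [set: Omega] (fun w => (e1 d pi (X k.+2 w) ^+ 2)%:E).
  exact/measurable_EFinP/measurable_funX.
rewrite EFinM; apply: (@le_trans _ _ (\int[Pr]_w ((Lam ^+ 2)%:E * (e1 d pi (X k.+2 w) ^+ 2)%:E))).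
  apply: ge0_le_integral => //.
  - by move=> w _; rewrite lee_fin sqr_ge0.
  - apply/measurable_EFinP/measurable_funX.
    exact: measurableT_comp mu (measurable_funP (X k.+2)).
  - exact: measurable_funeM.
  - move=> w _; rewrite -EFinM lee_fin -exprMn -[leLHS]real_normK ?num_real//.
    by rewrite lerXn2r ?nnegrE ?normr_ge0// ?(le_trans _ (poisson_bound _))// poisson_bound.
rewrite ge0_integralZl ?lee_fin ?sqr_ge0//; last by move=> w _; rewrite lee_fin sqr_ge0.
rewrite lee_wpmul2l ?lee_fin ?sqr_ge0//.
exact: (e1_sqr_chain dM md nupi q1 s1 qs Ny rE epsr piP XM k.+1).
Qed.

Variables (Chat t : R) (n : nat).
Hypothesis t0 : (0 < t)%R.
Hypothesis Chat0 : (0 < Chat)%R.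
Hypothesis RstarE :
  'E_Pr[fun w => (`|Rstar d P pi X f n w| ^+ 2)%R] <= (Chat * n%:R)%:E * dnorm d f ^+ 2.

Let measurable_Rstar : measurable_fun [set: Omega] (Rstar d P pi X f n).
Proof.
apply: (measurable_bigmaxr_nat (F := fun k w => `|u (X 1%N w) - u (X k.+1 w)|%R)) => k.
apply: measurableT_comp => //; apply: measurable_funB;
  exact: measurableT_comp mu (measurable_funP _).
Qed.

Let Sstar_tail_subset : [set w | (t < Sstar X f n w)%R] `<=`
  [set w | (t / 2 < Rstar d P pi X f n w)%R] `|` mart_hit P X u (t / 2) n.
Proof.
move=> w /=; apply: contraPP => /not_orP[/negP]; rewrite -leNgt => Rt nhit.
apply/negP; rewrite -leNgt.
apply: (bigmaxr_nat_le (F := fun k w => `|\sum_(1 <= j < k.+1) f (X j w)|%R)).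
  exact: ltW.
move=> k kn; rewrite sum_poisson_mart (splitr t) (le_trans (ler_normD _ _))// lerD//.
  apply: le_trans Rt.
  exact: (le_bigmaxr_nat (fun k w => `|u (X 1%N w) - u (X k.+1 w)|%R)).
by rewrite leNgt; apply/negP => /(mart_hitP kn).
Qed.

(** Chebyshev's inequality for [Rstar] and Doob's for the martingale, each at
    level [t / 2]. *)
Lemma Sstar_tail : Pr [set w | (t < Sstar X f n w)%R] <=
  (4 * n%:R / t ^+ 2 * (fine N * (Lam * e) ^+ 2 + Chat))%:E.
Proof.
have a0 : (0 <= t / 2)%R by rewrite divr_ge0// ltW.
have mS := measurable_tail t (measurable_Sstar X n mf).
have mA := measurable_tail (t / 2) measurable_Rstar.
have mB : measurable (mart_hit P X u (t / 2) n).
  exact: (past_measurable (@mart_hit_past _ _ _ P _ _ Pr X u mu ui (t / 2)%R n)).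
have PrA : ((t / 2) ^+ 2)%:E * Pr [set w | (t / 2 < Rstar d P pi X f n w)%R] <=
    (Chat * n%:R)%:E.
  apply: (le_trans (chebyshev_tail Pr a0 measurable_Rstar)).
  have -> : \int[Pr]_w (Rstar d P pi X f n w ^+ 2)%:E =
      'E_Pr[fun w => (`|Rstar d P pi X f n w| ^+ 2)%R].
    by rewrite unlock; apply: eq_integral => w _; rewrite real_normK ?num_real.
  apply: (le_trans RstarE).
  have dn0 : 0 <= dnorm d f.
    have [x [y xy]] := Tnontrivial.
    apply: (@le_trans _ _ (`|f x - f y| / d x y)%:E).
      by rewrite lee_fin divr_ge0// (is_metric_ge0 dM).
    by apply: ereal_sup_ubound; exists (x, y).
  rewrite -[leRHS]mule1 lee_wpmul2l ?lee_fin ?mulr_ge0 ?(ltW Chat0)//.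
  by rewrite expe2 -[leRHS]mule1 lee_pmul.
have PrB : ((t / 2) ^+ 2)%:E * Pr (mart_hit P X u (t / 2) n) <=
    (n%:R * (Lam ^+ 2 * (fine N * e ^+ 2)))%:E.
  apply: (le_trans (doob_kolmogorov XM mu ui a0 n)).
  rewrite EFinM; apply: (le_trans _ (mart_sqr_le XM mu ui n poisson_sqr_chain)).
  apply: ge0_subset_integral => //; last by move=> w _; rewrite lee_fin sqr_ge0.
  apply/measurable_EFinP/measurable_funX.
  exact: measurable_fun_past (@measurable_mart _ _ _ P _ _ Pr X u mu ui n).
have : ((t / 2) ^+ 2)%:E * Pr [set w | (t < Sstar X f n w)%R] <=
    (Chat * n%:R + n%:R * (Lam ^+ 2 * (fine N * e ^+ 2)))%:E.
  rewrite EFinD; apply: le_trans (leeD PrA PrB).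
  rewrite -ge0_muleDr// lee_wpmul2l ?lee_fin ?sqr_ge0//.
  apply: le_trans (measureU2 _ mA mB).
  by apply: le_measure; rewrite ?inE//; exact: measurableU.
rewrite -lee_pdivlMl ?exprn_gt0 ?divr_gt0// => /le_trans; apply.
rewrite -EFinM lee_fin le_eqVlt; apply/orP; left; apply/eqP.
by field; rewrite gt_eqF.
Qed.

End maximal_inequality.

Theorem theorem4p8 (R : realType)
    (disp : measure_display) (T : polishType disp R)
    (Tnontrivial : exists x y : T, x <> y)
    (d : T -> T -> R) (dmetric : lsc_metric d)
    (P : R.-pker T ~> T) (Pcontr : wasserstein_contractive d P)
    (pi : probability T R) (piP : unique_invariant P pi)
    (nu : probability T R) (nupi : nu `<< pi)
    (q s : R) (q1 : (1 < q)%R) (s1 : (1 < s)%R) (qs : (q^-1 + s^-1 = 1)%R)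
    (nuLq : 'N[pi]_q%:E['d (charge_of_finite_measure nu) '/d pi] < +oo)
    (r : R) (rE : r = (2 * s)%R) (epsr : eps d pi r < +oo)
    (disp' : measure_display) (Omega : measurableType disp')
    (Pr : probability Omega R) (X : nat -> {RV Pr >-> T})
    (Xmarkov : markov_chain P nu X)
    (Chat : R) (Chat0 : (0 < Chat)%R)
    (RstarE : forall g : T -> R, Lip0 d pi g -> forall n : nat, (0 < n)%N ->
       'E_Pr[fun w => (`|Rstar d P pi X g n w| ^+ 2)%R]
         <= (Chat * n%:R)%:E * dnorm d g ^+ 2)
    (n : nat) (n0 : (0 < n)%N) (t : R) (t0 : (0 < t)%R) :
  ereal_sup [set Pr [set w | (t < Sstar X f n w)%R]
            | f in [set f | Lip0 d pi f /\ dnorm d f <= 1]]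
  <= (4 * n%:R / t ^+ 2)%:E *
     (4%:E * 'N[pi]_q%:E['d (charge_of_finite_measure nu) '/d pi]
        * (Lambda d P * eps d pi r) ^+ 2 + Chat%:E).
Proof.
have dM := dmetric.1; have md := measurable_lsc_metric dmetric.
have piP1 := piP.1; have r0 : (0 < r)%R by rewrite rE mulr_gt0// (lt_trans ltr01).
have E1fin := eps_E1_lty dM md r0 epsr.
set N := 'N[pi]_q%:E[_] in nuLq *; set e := eps d pi r in epsr *; set Lam := Lambda d P.
have NE : (fine N)%:E = N by rewrite fineK// ge0_fin_numE ?Lnorm_ge0.
have eE : (fine e)%:E = e by rewrite fineK// ge0_fin_numE ?Lnorm_ge0.
have N_gt0 : 0 < N by exact: density_Lnorm_gt0.
have Lam_ge0 : 0 <= Lam by exact: Lambda_ge0.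
have e_ge0 : 0 <= e by exact: Lnorm_ge0.
have C0 : (0 < 4 * n%:R / t ^+ 2)%R by rewrite divr_gt0 ?exprn_gt0 ?mulr_gt0 ?ltr0n.
have sq_ge0 : 0 <= (Lam * e) ^+ 2 by rewrite expe2 mule_ge0// mule_ge0.
have NS_ge0 : 0 <= 4%:E * N * (Lam * e) ^+ 2.
  by rewrite mule_ge0// mule_ge0// ltW.
apply: ge_ereal_sup => _ [f /= [f_Lip0 f_dnorm] <-].
have [Lamy|] := ltP Lam +oo; last first.
  rewrite leye_eq => /eqP LamE.
  (* The bound is infinite unless [eps] is zero. *)
  have [e0|e_neq0] := eqVneq e 0.
    rewrite (Sstar_tail_degenerate dM md nupi q1 s1 qs nuLq rE epsr piP1 Xmarkov)//.
      by rewrite mule_ge0 ?lee_fin ?(ltW C0)// adde_ge0// lee_fin ltW.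
    by rewrite -/e e0.
  have e_gt0 : 0 < e by rewrite lt0e e_neq0.
  rewrite LamE gt0_mulye//
    mulyy gt0_muley ?mule_gt0//.
  by rewrite addye// gt0_muley ?lte_fin// leey.
have := Sstar_tail Tnontrivial dM md nupi q1 s1 qs nuLq rE epsr piP1 Pcontr.1 Lamy
  Xmarkov f_Lip0 f_dnorm t0 Chat0 (RstarE f f_Lip0 n n0).
move=> /le_trans; apply.
have LamE : (fine Lam)%:E = Lam by rewrite fineK// ge0_fin_numE.
have n_ge0 : (0 <= fine N)%R by rewrite fine_ge0// ltW.
move: n_ge0; rewrite -/N -/e -/Lam -[in X in _ <= X]NE -[in X in _ <= X]eE -[in X in _ <= X]LamE.
move: (fine N) (fine e) (fine Lam) => nr er lr nr_ge0.
rewrite -!EFinM lee_fin.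
rewrite ler_wpM2l ?(ltW C0)// lerD2r -expr2 -mulrA.
by rewrite ler_peMl ?ler1n// mulr_ge0 ?sqr_ge0.
Qed.
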